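(* Let $L,a,b,c>0$ be constants and let $p\in L^1[0,L]$ satisfy $$\frac{2a^2M^2}{bL^2N}>\|p\|_1 .$$ Consider the boundary value problem $$w''''(x)-\Big(a+b\int_0^Lw(t)\,dt\Big)w''(x)+c\int_0^Lw(t)\,dt=p(x),\quad x\in(0,L),\qquad w(0)=w(L)=w''(0)=w''(L)=0,$$ and let $w=S\varphi$ be its solution corresponding to the unique fixed point $\varphi$ of the operator $A$ in the closed ball $B[0,2\|p\|_1]$ (see context). If $\widetilde w\in W^{4,1}[0,L]$ is any solution of this boundary value problem satisfying $\int_0^L\widetilde w(x)\,dx\ge0$, then $\widetilde w=w$. In particular, a solution of the boundary value problem in the class $$\mathcal X_+=\Big\{u\in W^{4,1}[0,L]:\int_0^Lu(x)\,dx\ge0\Big\}$$ is unique whenever it exists.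
   Context: $\|\cdot\|_1$ is the norm of $L^1[0,L]$, and $B[0,2\|p\|_1]=\{\varphi\in L^1[0,L]:\|\varphi\|_1\le2\|p\|_1\}$. Differential equations are understood almost everywhere for functions in $W^{4,1}[0,L]$. Notation: $$M=1+c\Big(\frac{L^3}{12a}-\frac{L}{a^2}+\frac{2}{a^{5/2}}\tanh\frac{\sqrt aL}{2}\Big),\qquad N=1+c\Big(\frac{5L^3}{24a}-\frac{L}{a^2}+\frac{1}{a^{5/2}}\big(2-\tfrac{aL^2}{4}\big)\tanh\frac{\sqrt aL}{2}\Big).$$ Let $G:[0,L]^2\to\mathbb R$ be the Green function of $w\mapsto w''''-aw''$ with boundary conditions $w(0)=w(L)=w''(0)=w''(L)=0$, i.e. $G(x,s)=\frac{x(L-s)}{aL}-\frac{\sinh(\sqrt a x)\sinh(\sqrt a(L-s))}{a\sqrt a\sinh(\sqrt aL)}$ for $0\le x\le s\le L$, and $G(x,s)=G(s,x)$ for $s\le x$. For $\varphi\in L^1[0,L]$, the linear problem $w''''-aw''+c\int_0^Lw(t)\,dt=\varphi$ on $(0,L)$, $w(0)=w(L)=w''(0)=w''(L)=0$, has a unique solution $w=S\varphi\in W^{4,1}[0,L]$, given by $$(S\varphi)(x)=\int_0^LG(x,s)\varphi(s)\,ds-\frac{c\int_0^LG(x,s)\,ds}{1+c\int_0^L\int_0^LG(t,s)\,ds\,dt}\int_0^L\int_0^LG(t,s)\varphi(s)\,ds\,dt .$$ The operator $A:L^1[0,L]\to L^1[0,L]$ is defined by $$(A\varphi)(x)=p(x)+b\Big(\int_0^Lw(t)\,dt\Big)w''(x),\qquad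 w=S\varphi .$$ Under the stated condition on $p$, $A$ has a unique fixed point $\varphi$ in $B[0,2\|p\|_1]$, and $w=S\varphi$ is then a solution of the boundary value problem. *)

(* Defs.v *)
From HB Require Import structures.
From mathcomp Require Import all_boot all_order all_algebra.
From mathcomp Require Import all_classical all_reals all_analysis.

Set Implicit Arguments.
Unset Strict Implicit.
Unset Printing Implicit Defensive.

Import Order.TTheory GRing.Theory Num.Theory.
Import numFieldNormedType.Exports.

Local Open Scope classical_set_scope.
Local Open Scope ring_scope.

(* Functions on [0, L] are represented by total functions R -> R of which only
   the values on [0, L] matter; elements of L^1[0, L] by Borel representatives,
   compared almost everywhere. *)

Definition sinh {R : realType} (x : R) : R := (expR x - expR (- x)) / 2.
Definition cosh {R : realType} (x : R) : R := (expR x + expR (- x)) / 2.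
Definition tanh {R : realType} (x : R) : R := sinh x / cosh x.

Definition in_L1 {R : realType} (L : R) (f : R -> R) : Prop :=
  (@lebesgue_measure R).-integrable `[0, L] (EFin \o f).

Definition integ {R : realType} (L : R) (f : R -> R) : R :=
  \int[@lebesgue_measure R]_(x in `[0, L]) f x.

Definition norm_L1 {R : realType} (L : R) (f : R -> R) : R :=
  integ L (fun x => `|f x|).

(* Absolute continuity (epsilon-delta) on the open interval ]l, r[. As the
   endpoints may be approached uniformly, this amounts to f|]l, r[ extending to
   an absolutely continuous function on [l, r]. *)
Definition abs_continuous {R : realType} (l r : R) (f : R -> R) : Prop :=
  forall e : R, 0 < e -> exists2 d : R, 0 < d &
    forall (n : nat) (s t : 'I_n -> R),
      (forall i, [/\ l < s i, s i <= t i & t i < r]) ->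
      trivIset setT (fun i => `]s i, t i[%classic) ->
      \sum_(i < n) (t i - s i) < d ->
      \sum_(i < n) `|f (t i) - f (s i)| < e.

(* W^{4,1}[0, L]: w is continuous on [0, L] and three times differentiable on
   ]0, L[, w''' is absolutely continuous, and w'''', which exists almost
   everywhere, is in L^1. Absolute continuity of w''' forces w', w'', w''' to
   have limits at 0 and L, so that w is of class C^3 up to the boundary. *)
Definition W41 {R : realType} (L : R) (w : R -> R) : Prop :=
  [/\ derivable_oo_LRcontinuous w 0 L,
      {in `]0, L[, forall x,
        derivable w^`(1)%classic x 1 /\ derivable w^`(2)%classic x 1},
      abs_continuous 0 L w^`(3)%classic,
      {ae @lebesgue_measure R, forall x, x \in `]0, L[ ->
        derivable w^`(3)%classic x 1}
    & in_L1 L w^`(4)%classic].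

Definition constM {R : realType} (L a c : R) : R :=
  1 + c * (L ^+ 3 / (12 * a) - L / a ^+ 2
           + 2 / a `^ (5 / 2) * tanh (Num.sqrt a * L / 2)).

Definition constN {R : realType} (L a c : R) : R :=
  1 + c * (5 * L ^+ 3 / (24 * a) - L / a ^+ 2
           + 1 / a `^ (5 / 2) * (2 - a * L ^+ 2 / 4)
             * tanh (Num.sqrt a * L / 2)).

Definition green_below {R : realType} (L a x s : R) : R :=
  x * (L - s) / (a * L)
  - sinh (Num.sqrt a * x) * sinh (Num.sqrt a * (L - s))
    / (a * Num.sqrt a * sinh (Num.sqrt a * L)).

Definition green {R : realType} (L a x s : R) : R :=
  if x <= s then green_below L a x s else green_below L a s x.

Definition solS {R : realType} (L a c : R) (phi : R -> R) (x : R) : R :=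
  integ L (fun s => green L a x s * phi s)
  - c * integ L (fun s => green L a x s)
    / (1 + c * integ L (fun t => integ L (fun s => green L a t s)))
    * integ L (fun t => integ L (fun s => green L a t s * phi s)).

Definition opA {R : realType} (L a b c : R) (p phi : R -> R) (x : R) : R :=
  let w := solS L a c phi in p x + b * integ L w * w^`(2)%classic x.

Definition fixed_point_in_ball {R : realType} (L a b c : R) (p phi : R -> R) :
    Prop :=
  [/\ in_L1 L phi, norm_L1 L phi <= 2 * norm_L1 L p
    & {ae @lebesgue_measure R,
        forall x, x \in `[0, L] -> opA L a b c p phi x = phi x}].

(* The derivatives w^`(n) are two-sided, hence meaningful only in ]0, L[; the
   boundary values of w'' are those of its continuous extension to [0, L]. *)
Definition bvp_solution {R : realType} (L a b c : R) (p w : R -> R) : Prop :=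
  [/\ {ae @lebesgue_measure R, forall x, x \in `]0, L[ ->
        w^`(4)%classic x - (a + b * integ L w) * w^`(2)%classic x + c * integ L w = p x},
      w 0 = 0, w L = 0,
      w^`(2)%classic x @[x --> 0^'+] --> (0 : R)
    & w^`(2)%classic x @[x --> L^'-] --> (0 : R)].

Definition Xplus {R : realType} (L : R) (w : R -> R) : Prop :=
  W41 L w /\ 0 <= integ L w.

(* Main.v *)
(* Write q for the integral of w and al = a + b q. Then w solves the boundary
   value problem iff w'''' - al w'' = p - c q with hinged ends, and testing this
   with the solution g_al of g'''' - al g'' = 1 gives a scalar equation for q,
     q (1 + c K(al)) = \int g_al p,    K(al) = \int g_al,    K(a) = (M - 1) / c.
   Two roots with al, be >= a/2 coincide: subtracting their equations,
   |g_al - g_be| <= |al - be| / (al be) * L^2/8 bounds the right-hand side, while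
   (al - a) K(al) - (be - a) K(be) >= (al - be) a^2 / (4 al be) K(a) for al > be
   bounds the left-hand side, and the two bounds contradict the smallness of p
   (with M <= N). Solutions with q >= 0 have al >= a; a fixed point in the ball
   has |q| <= L^2 |p|_1 / (4 a M) < a / (2 b), hence al >= a/2. Equal roots give
   the same linear problem, whose solution is represented by its Green function.
   The functional-analytic input is the fundamental theorem of calculus for
   absolutely continuous functions. *)
Require Import Defs.
From mathcomp Require Import all_boot all_order all_algebra.
From mathcomp Require Import all_classical all_reals all_analysis.
From mathcomp Require Import measurable_realfun.
From mathcomp Require Import ring lra.
Import Order.TTheory GRing.Theory Num.Theory.
Import numFieldNormedType.Exports.
Local Open Scope classical_set_scope.
Local Open Scope ring_scope.
Set Implicit Arguments.
Unset Strict Implicit.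

(** * Absolutely continuous functions *)

(** The contraction property behind the fixed point only concerns the ball, and a solution with
    nonnegative integral need not come from a function in that ball. The comparison is therefore
    made between the real numbers q, where no a priori bound on the second solution is needed. The
    threshold a/2 is due to the fixed point: the ball controls |q| but not its sign, so its
    coefficient may fall below a. This costs a factor 2 in each of two pointwise estimates, hence
    the 4 in the lower bound. After multiplication by 4 al be / (al - be) the two bounds read 4 al
    be + c a^2 K(a) <= b L^2 |p|_1 / 2. Since 4 al be >= a^2, the left side is at least a^2 M, which
    is what the hypothesis on p excludes. Derivatives are meaningful in ]0, L[ only. Solutions are
    therefore carried together with functions representing their derivatives, and boundary data
    enter as one-sided limits. *)

Lemma cousin (R : realType) (P : R -> R -> Prop) (x y : R) : x < y ->
  (forall s t u, x <= s -> s < t -> t < u -> u <= y ->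
     P s t -> P t u -> P s u) ->
  (forall z, x <= z -> z <= y -> exists2 d, 0 < d &
     forall s t, x <= s -> s <= z -> z <= t -> t <= y -> s < t -> t - s < d ->
       P s t) ->
  P x y.
Proof.
move=> xy Padd Ploc.
(* Points reachable from [x]; the alternative [t = x] is there because [P x x] is not assumed. The
   local property at the supremum [m] joins a point of [S] close below [m] to [m], and, if [m < y],
   joins [m] to a point beyond it. *)
pose S := [set t | [/\ x <= t, t <= y & t = x \/ P x t]].
have Sx : S x by split; [| exact: ltW | left].
have supS : has_sup S by split; [exists x | exists y => t []].
set m := sup S.
have xm : x <= m by apply: sup_upper_bound.
have my : m <= y by apply: ge_sup; [exists x | move=> t []].
have [d d0 Pd] := Ploc m xm my.
have d20 : 0 < d / 2 by lra.
have [t [xt ty tP] mt] := sup_adherent d20 supS.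
rewrite -/m in mt.
have tm : t <= m by apply: sup_upper_bound.
have mP : m = x \/ P x m.
  have [tmE|ntm] := eqVneq t m; first by rewrite -tmE.
  have ltm : t < m by rewrite lt_neqAle ntm.
  have Ptm : P t m by apply: Pd => //; lra.
  right; case: tP => [<- //|Pxt].
  have [xtE|nxt] := eqVneq x t; first by rewrite xtE.
  by apply: (Padd x t m) => //; rewrite lt_neqAle nxt.
have [myE|nmy] := eqVneq m y.
  by rewrite -myE; case: mP => // mx; move: xy; rewrite -myE mx ltxx.
have lmy : m < y by rewrite lt_neqAle nmy.
pose u := Num.min (m + d / 2) y.
have mu : m < u by rewrite lt_min lmy andbT; lra.
have uy : u <= y by rewrite ge_min lexx orbT.
have um : u <= m + d / 2 by rewrite ge_min lexx.
have Pmu : P m u by apply: Pd => //; lra.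
suff : S u by move/(sup_upper_bound supS); rewrite -/m leNgt mu.
split=> //; first by rewrite ltW // (le_lt_trans xm).
right; case: mP => [<- //|Pxm].
have [xmE|nxm] := eqVneq x m; first by rewrite xmE.
by apply: (Padd x m u) => //; rewrite lt_neqAle nxm.
Qed.

Lemma measure_disjoint_itvoo (R : realType) n (a b : 'I_n -> R) :
  (forall i, a i <= b i) -> trivIset setT (fun i => `]a i, b i[%classic) ->
  @lebesgue_measure R (\big[setU/set0]_(i < n) `]a i, b i[%classic) =
  (\sum_(i < n) (b i - a i))%:E.
Proof.
move=> ab tab.
apply: etrans.
  exact: (@measure_bigsetU_ord _ _ _ (@lebesgue_measure R) n predT
    (fun i => `]a i, b i[%classic) (fun=> measurable_itv _) tab).
rewrite -sumEFin; apply: eq_bigr => i _; rewrite /= lebesgue_measure_itv/= lte_fin.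
by have := ab i; case: ltgtP => // -> _; rewrite subrr.
Qed.

Section abs_continuous_monotone.
Variables (R : realType) (l r : R).
Notation mu := (@lebesgue_measure R).

(** The part of a partition of [s, t] to which absolute continuity will be applied. Keeping all
    endpoints in [s, t] makes families over adjacent intervals disjoint from each other, so that
    they can be concatenated. *)
Let fam (O : set R) (s t : R) n (a b : 'I_n -> R) :=
  (forall i, [/\ s <= a i, a i <= b i, b i <= t & `]a i, b i[ `<=` O]) /\
  trivIset setT (fun i => `]a i, b i[%classic).

Let fam_cat (O : set R) s t u n (a b : 'I_n -> R) m (a' b' : 'I_m -> R) :
  s <= t -> t <= u -> fam O s t a b -> fam O t u a' b' ->
  fam O s u
    (fun i => match fintype.split i with inl j => a j | inr k => a' k end)
    (fun i => match fintype.split i with inl j => b j | inr k => b' k end).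
Proof.
move=> st tu [abO tab] [abO' tab']; split=> [i|].
  case: (fintype.split i) => j.
    by case: (abO j) => h1 h2 h3 h4; split=> //; apply: le_trans tu.
  by case: (abO' j) => h1 h2 h3 h4; split=> //; apply: le_trans h1.
move=> i j _ _.
have lsp k : fintype.split (lshift m k : 'I_(n + m)) = inl k := unsplitK (inl k).
have rsp k : fintype.split (rshift n k : 'I_(n + m)) = inr k := unsplitK (inr k).
case: (split_ordP i) => i' ->; case: (split_ordP j) => j' ->;
  rewrite ?lsp ?rsp.
- by move/(tab i' j' I I) ->.
- case=> z [/=]; rewrite !in_itv/= => /andP[_ zb] /andP[az _].
  case: (abO i') => _ _ bt _; case: (abO' j') => ta _ _ _; exfalso; lra.
- case=> z [/=]; rewrite !in_itv/= => /andP[az _] /andP[_ zb].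
  case: (abO' i') => ta _ _ _; case: (abO j') => _ _ bt _; exfalso; lra.
- by move/(tab' i' j' I I) ->.
Qed.

Let sum_split n m (V : zmodType) (f : 'I_n -> V) (g : 'I_m -> V) :
  \sum_(i < n + m) match fintype.split i with inl j => f j | inr k => g k end =
  \sum_(i < n) f i + \sum_(i < m) g i.
Proof.
rewrite big_split_ord; congr (_ + _); apply: eq_bigr => i _.
  by rewrite (unsplitK (inl i)).
by rewrite (unsplitK (inr i)).
Qed.

Let fam_measure (O : set R) (s t : R) n (a b : 'I_n -> R) :
  measurable O -> fam O s t a b -> ((\sum_(i < n) (b i - a i))%:E <= mu O)%E.
Proof.
move=> mO [abO tab]; rewrite -measure_disjoint_itvoo//; last first.
  by move=> i; case: (abO i).
rewrite le_measure ?inE//; first exact: bigsetU_measurable.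
move=> z; rewrite -bigcup_seq => -[i _]; case: (abO i) => _ _ _; exact.
Qed.

(** The point [z] lies anywhere between [s] and [t], as for a tag in a gauge partition; the
    increment is split at [z] and the difference quotient is used on each side. *)
Lemma derive_ge0_local (F : R -> R) (z dv k : R) :
  is_derive z 1 F dv -> 0 <= dv -> 0 < k -> exists2 d, 0 < d &
    forall s t, s <= z -> z <= t -> t - s < d -> F s - F t <= k * (t - s).
Proof.
move=> Fz dv0 k0.
have : (fun h => h^-1 *: ((F \o shift z) (h *: 1) - F z)) @ 0^' --> dv.
  by case: Fz => dF <-; exact: dF.
move/cvgrPdist_lt => /(_ _ k0) [d /= d0 dP].
have {}dP h : h != 0 -> `|h| < d -> - k < (F (h + z) - F z) / h.
  move=> h0 hd; have := dP h; rewrite /= sub0r normrN => /(_ hd h0).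
  rewrite [h *: 1]mulr1 => /ltr_normlW.
  rewrite [_ *: _]mulrC; lra.
exists d => // s t sz zt tsd.
have h1 : F z - F t <= k * (t - z).
  have [<-|zt'] := eqVneq z t; first by rewrite !subrr mulr0.
  have tz : 0 < t - z by rewrite subr_gt0 lt_neqAle zt'.
  have := dP (t - z); rewrite gt_eqF// gtr0_norm// subrK => /(_ isT).
  rewrite ltr_pdivlMr//.
  have -> : t - z < d by lra.
  move/(_ isT); lra.
have h2 : F s - F z <= k * (z - s).
  have [<-|sz'] := eqVneq s z; first by rewrite !subrr mulr0.
  have tz : s - z < 0 by rewrite subr_lt0 lt_neqAle sz'.
  have := dP (s - z); rewrite lt_eqF// ltr0_norm// subrK => /(_ isT).
  rewrite ltr_ndivlMr//.
  have -> : - (s - z) < d by lra.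
  move/(_ isT); lra.
lra.
Qed.

(* A null set of bad points is covered by an open set of small measure, so a
   Cousin partition splits [x, y] into intervals where F decreases slowly and
   intervals of small total length, to which absolute continuity applies. *)
Lemma abs_continuous_le (F : R -> R) : abs_continuous l r F ->
  {ae mu, forall x, x \in `]l, r[ -> exists2 d, is_derive x 1 F d & 0 <= d} ->
  forall x y, l < x -> x <= y -> y < r -> F x <= F y.
Proof.
move=> acF [N [mN N0 FN]] x y lx xy yr.
move: xy; rewrite le_eqVlt => /predU1P[->//|xy].
apply/ler_addgt0Pr => e e0.
have e20 : 0 < e / 2 by lra.
have [d d0 dP] := acF _ e20.
have Noo : (mu N < +oo)%E by rewrite N0 ltry.
have [U [oU NO muU]] := lebesgue_regularity_outer mN Noo d0.
have mU : measurable U by exact: open_measurable.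
(* Outer regularity bounds the measure of [U] minus [N]; since [N] is null, this bounds the measure
   of [U]. *)
have {}muU : (mu U < d%:E)%E.
  by rewrite -(setDUK NO) setUC measureU0//; exact: measurableD.
pose k := e / 2 / (y - x).
have yx0 : 0 < y - x by rewrite subr_gt0.
have k0 : 0 < k by rewrite divr_gt0.
(* The drop of [F] is charged to a slope [k] and to the variation over a family inside [U]. Both
   charges are additive, and over [x, y] the slope costs [e / 2] and the variation less than
   [e / 2]. *)
pose P s t := exists n (a b : 'I_n -> R), fam U s t a b /\
   F s - F t <= k * (t - s) + \sum_(i < n) `|F (b i) - F (a i)|.
suff [n [a [b [abU Fxy]]]] : P x y.
  have : \sum_(i < n) `|F (b i) - F (a i)| < e / 2.
    apply: dP.
    - by move=> i; case: abU => /(_ i)[? ? ? _] _; split=> //;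
        [apply: lt_le_trans lx _|apply: le_lt_trans yr].
    - by case: abU.
    - by rewrite -lte_fin; apply: le_lt_trans (fam_measure mU abU) muU.
  have : k * (y - x) = e / 2 by rewrite /k divfK// gt_eqF.
  lra.
apply: cousin => //.
- move=> s t u xs st tu uy [n [a [b [abU Fst]]]] [m [a' [b' [abU' Ftu]]]].
  exists (n + m)%N; eexists; eexists; split.
    exact: (fam_cat (ltW st) (ltW tu) abU abU').
  have -> : \sum_(i < n + m)
     `|F (match fintype.split i with inl j => b j | inr k => b' k end) -
       F (match fintype.split i with inl j => a j | inr k => a' k end)| =
     \sum_(i < n) `|F (b i) - F (a i)| + \sum_(i < m) `|F (b' i) - F (a' i)|.
    by rewrite -sum_split; apply: eq_bigr => i _; case: (fintype.split i).
  lra.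
- move=> z xz zy.
  (* At a tag in [U] the whole interval becomes the family. A tag outside [U] is outside [N], so the
     derivative exists and is nonnegative there, and the empty family suffices. *)
  have [Uz|nUz] := pselect (U z).
    have [D /= D0 DU] := oU z Uz.
    exists D => // s t xs sz zt ty st tsD.
    exists 1%N, (fun=> s), (fun=> t); split; last first.
      rewrite big_ord1.
      have : F s - F t <= `|F t - F s| by rewrite distrC ler_norm.
      have : 0 <= k * (t - s) by apply: mulr_ge0; lra.
      lra.
    split=> [i|]; last by move=> i j _ _ _; rewrite !ord1.
    split=> //; first exact: ltW.
    move=> w /=; rewrite in_itv/= => /andP[sw wt]; apply: DU => /=.
    rewrite ltr_norml; apply/andP; split; lra.
  have [dv Fz dv0] : exists2 dv, is_derive z 1 F dv & 0 <= dv.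
    apply: contrapT => nF; apply: nUz; apply: NO; apply: FN => /= H.
    by apply: nF; apply: H; rewrite in_itv/=; apply/andP; split; lra.
  have [D D0 DP] := derive_ge0_local Fz dv0 k0.
  exists D => // s t xs sz zt ty st tsD.
  exists 0%N, (fun=> 0), (fun=> 0); split; last by rewrite big_ord0 addr0 DP.
  by split; case.
Qed.

End abs_continuous_monotone.

Section abs_continuous_theory.
Variable R : realType.
Implicit Types (l r : R) (f g : R -> R).
Notation mu := (@lebesgue_measure R).

Lemma lebesgue_aeS (P Q : R -> Prop) : (forall x, P x -> Q x) ->
  {ae mu, forall x, P x} -> {ae mu, forall x, Q x}.
Proof.
by move=> PQ; apply: filterS; first exact: (ae_filter_ringOfSetsType mu).
Qed.

Lemma lebesgue_aeS2 (P Q S : R -> Prop) : (forall x, P x -> Q x -> S x) ->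
  {ae mu, forall x, P x} -> {ae mu, forall x, Q x} -> {ae mu, forall x, S x}.
Proof.
by move=> PQS; apply: filterS2; first exact: (ae_filter_ringOfSetsType mu).
Qed.

Lemma abs_continuousS l r l' r' f : l <= l' -> r' <= r ->
  abs_continuous l r f -> abs_continuous l' r' f.
Proof.
move=> ll' rr' acf e e0; have [d d0 dP] := acf e e0; exists d => // n s t st.
apply: dP => i; case: (st i) => ls ? tr; split=> //.
  exact: le_lt_trans ls.
exact: lt_le_trans rr'.
Qed.

Lemma abs_continuous_lip l r f (K : R) :
  (forall x y, l < x -> x <= y -> y < r -> `|f y - f x| <= K * (y - x)) ->
  abs_continuous l r f.
Proof.
move=> lipf e e0; exists (e / (`|K| + 1)) => [|n s t st _ std].
  by rewrite divr_gt0// ltr_wpDl.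
have K0 : 0 < `|K| + 1 by rewrite ltr_wpDl.
apply: (@le_lt_trans _ _ (\sum_(i < n) (`|K| + 1) * (t i - s i))).
  apply: ler_sum => i _; case: (st i) => ls sit tr.
  apply: (le_trans (lipf _ _ ls sit tr)); apply: ler_wpM2r; first lra.
  by have := ler_norm K; lra.
by rewrite -mulr_sumr -ltr_pdivlMl// mulrC.
Qed.

(** The common source of closure under sums, differences and products: [K] is 1 for the first two
    and comes from bounds on the factors for the third. *)
Lemma abs_continuous_comb2 l r f g (h : R -> R) (K : R) : 0 < K ->
  (forall x y, l < x -> x < r -> l < y -> y < r ->
     `|h y - h x| <= K * (`|f y - f x| + `|g y - g x|)) ->
  abs_continuous l r f -> abs_continuous l r g -> abs_continuous l r h.
Proof.
move=> K0 hfg acf acg e e0.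
have e20 : 0 < e / (2 * K) by rewrite divr_gt0// mulr_gt0.
have [d d0 dP] := acf _ e20; have [d' d0' dP'] := acg _ e20.
exists (Num.min d d') => [|n s t st tst]; first by rewrite lt_min d0.
rewrite lt_min => /andP[sd sd'].
apply: (@le_lt_trans _ _
  (\sum_(i < n) K * (`|f (t i) - f (s i)| + `|g (t i) - g (s i)|))).
  apply: ler_sum => i _; case: (st i) => ls sit tr.
  apply: hfg => //; first exact: le_lt_trans tr.
  exact: lt_le_trans sit.
rewrite -mulr_sumr big_split/=.
have := dP n s t st tst sd; have := dP' n s t st tst sd'.
rewrite !ltr_pdivlMr ?mulr_gt0//; lra.
Qed.

Lemma abs_continuousD l r f g : abs_continuous l r f -> abs_continuous l r g ->
  abs_continuous l r (fun x => f x + g x).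
Proof.
apply: (@abs_continuous_comb2 _ _ _ _ _ 1) => // x y _ _ _ _.
rewrite mul1r; apply: le_trans (ler_normD _ _).
by rewrite le_eqVlt; apply/orP; left; apply/eqP; congr (`|_|); ring.
Qed.

Lemma abs_continuousB l r f g : abs_continuous l r f -> abs_continuous l r g ->
  abs_continuous l r (fun x => f x - g x).
Proof.
apply: (@abs_continuous_comb2 _ _ _ _ _ 1) => // x y _ _ _ _.
rewrite mul1r; apply: le_trans (ler_normB _ _).
by rewrite le_eqVlt; apply/orP; left; apply/eqP; congr (`|_|); ring.
Qed.

Lemma abs_continuous_unif l r f (e : R) : abs_continuous l r f -> 0 < e ->
  exists2 d, 0 < d & forall x y, l < x -> x < r -> l < y -> y < r ->
    `|y - x| < d -> `|f y - f x| < e.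
Proof.
move=> acf e0; have [d d0 dP] := acf e e0; exists d => //.
suff H x y : l < x -> y < r -> x <= y -> `|y - x| < d -> `|f y - f x| < e.
  move=> x y lx xr ly yr; have [xy|/ltW yx] := leP x y; first exact: H.
  by rewrite distrC => ?; rewrite distrC; apply: H.
move=> lx yr xy yxd.
have := dP 1%N (fun=> x) (fun=> y); rewrite !big_ord1; apply => //.
  by move=> i j _ _ _; rewrite !ord1.
by rewrite (le_lt_trans (ler_norm _)).
Qed.

Lemma abs_continuous_continuous l r f : abs_continuous l r f ->
  forall x, x \in `]l, r[ -> {for x, continuous f}.
Proof.
move=> acf x xlr; apply/cvgrPdist_lt => e e0.
have [d d0 dP] := abs_continuous_unif acf e0.
near=> y.
have ylr : y \in `]l, r[ by near: y; exact: near_in_itvoo.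
have := xlr; rewrite in_itv/= => /andP[lx xr].
have := ylr; rewrite in_itv/= => /andP[ly yr].
by apply: dP => //; near: y; exact: (@cvgr_dist_lt _ _ _ (nbhs x) _ id).
Unshelve. all: by end_near. Qed.

(** Uniform continuity with tolerance 1 bounds the increment over a step of length [d / 2], and
    finitely many such steps cross the interval. Half of [d] turns the non-strict step length into
    the strict inequality required. *)
Lemma abs_continuous_bounded l r f : abs_continuous l r f ->
  exists M, forall x, x \in `]l, r[ -> `|f x| <= M.
Proof.
move=> acf; have [rl|lr] := leP r l.
  by exists 0 => x; rewrite in_itv/= => /andP[? ?]; lra.
have [d d0 dP] := abs_continuous_unif acf (@ltr01 R).
pose d2 := d / 2; have d20 : 0 < d2 by rewrite divr_gt0.
have step n : forall x y, l < x -> x < r -> l < y -> y < r ->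
    `|y - x| <= d2 * n%:R -> `|f y - f x| <= n%:R.
  elim: n => [|n IH] x y lx xr ly yr.
    by rewrite mulr0 normr_le0 subr_eq0 => /eqP ->; rewrite subrr normr0.
  (* [z] cuts the segment from [x] to [y] in the ratio 1 : n, leaving one step before it and [n]
     steps after it. *)
  move=> yx; pose z := x + (y - x) / n.+1%:R.
  have n0 : 0 < n.+1%:R :> R by rewrite ltr0n.
  have n1 : n.+1%:R != 0 :> R by rewrite gt_eqF.
  have zE : z = (x * n%:R + y) / n.+1%:R.
    by rewrite /z -[n.+1]addn1 natrD; field; rewrite -natr1 in n1.
  have zlr : l < z /\ z < r.
    rewrite zE ltr_pdivlMr// ltr_pdivrMr// -natr1.
    have := ler0n R n; split; nra.
  have h1 : `|f z - f x| < 1.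
    apply: dP => //; try by case: zlr.
    rewrite /z addrC addKr normrM normfV (gtr0_norm n0) ltr_pdivrMr//.
    apply: le_lt_trans yx _; rewrite /d2; nra.
  have h2 : `|f y - f z| <= n%:R.
    apply: IH => //; try by case: zlr.
    have -> : y - z = (y - x) * (n%:R / n.+1%:R).
      by rewrite /z -[n.+1]addn1 natrD; field; rewrite -natr1 in n1.
    rewrite normrM [`|n%:R / _|]ger0_norm ?divr_ge0//.
    rewrite mulrA ler_pdivrMr//; apply: le_trans (ler_wpM2r _ yx) _ => //.
    by rewrite -!mulrA [n.+1%:R * _]mulrC.
  have -> : f y - f x = (f y - f z) + (f z - f x) by ring.
  rewrite -natr1; apply: le_trans (ler_normD _ _) _; lra.
pose m := (l + r) / 2.
have [n nP] : exists n, r - l <= d2 * n%:R.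
  exists (Num.truncn ((r - l) / d2)).+1; rewrite mulrC -ler_pdivrMr//.
  by apply/ltW; rewrite truncnS_gt.
exists (n%:R + `|f m|) => x; rewrite in_itv/= => /andP[lx xr].
have -> : f x = (f x - f m) + f m by ring.
apply: le_trans (ler_normD _ _) _; rewrite lerD2r.
apply: step => //; rewrite /m; try lra.
by apply: le_trans nP; rewrite ler_norml; apply/andP; split; lra.
Qed.

Lemma abs_continuousM l r f g : abs_continuous l r f -> abs_continuous l r g ->
  abs_continuous l r (fun x => f x * g x).
Proof.
move=> acf acg.
have [M Mf] := abs_continuous_bounded acf.
have [M' Mg] := abs_continuous_bounded acg.
apply: (@abs_continuous_comb2 _ _ _ _ _ (`|M| + `|M'| + 1)) acf acg.
  by rewrite ltr_wpDl// addr_ge0.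
move=> x y lx xr ly yr.
have -> : f y * g y - f x * g x = g y * (f y - f x) + f x * (g y - g x) by ring.
have Mf' : `|f x| <= `|M| + `|M'| + 1.
  apply: le_trans (Mf _ _) _; first by rewrite in_itv/= lx.
  have := ler_norm M; have := normr_ge0 M'; lra.
have Mg' : `|g y| <= `|M| + `|M'| + 1.
  apply: le_trans (Mg _ _) _; first by rewrite in_itv/= ly.
  have := ler_norm M'; have := normr_ge0 M; lra.
rewrite [leRHS]mulrDr; apply: le_trans (ler_normD _ _) _; rewrite !normrM.
by apply: lerD; apply: ler_wpM2r.
Qed.

Lemma abs_continuous_derive l r f (df : R -> R) (M : R) :
  (forall x, x \in `]l, r[ -> is_derive x 1 f (df x)) ->
  (forall x, x \in `]l, r[ -> `|df x| <= M) -> abs_continuous l r f.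
Proof.
move=> fdf Mdf; apply: (@abs_continuous_lip _ _ _ M) => x y lx xy yr.
have sub z : z \in `[x, y] -> z \in `]l, r[.
  by rewrite !in_itv/= => /andP[xz zy]; apply/andP; split; lra.
have dxy z : z \in `]x, y[ -> is_derive z 1 f (df z).
  by rewrite in_itv/= => /andP[xz zy]; apply/fdf/sub; rewrite in_itv/= !ltW.
have cxy : {within `[x, y], continuous f}.
  by apply: derivable_within_continuous => z /sub /fdf [].
have [z zxy ->] := MVT_segment xy dxy cxy.
by rewrite normrM (@ger0_norm _ (y - x)) ?subr_ge0// ler_wpM2r ?subr_ge0// Mdf// sub.
Qed.

(** The integral of |f| over a set of small measure is small; this is applied to the union of the
    given intervals, whose measure is the sum of their lengths. *)
Lemma abs_continuous_integral (u l r : R) f : u <= l ->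
  mu.-integrable setT (EFin \o f) ->
  abs_continuous l r (fun x => \int[mu]_(t in `[u, x]) f t).
Proof.
move=> ul intf e e0.
have [d [d0 dP]] := integral_normr_continuous intf e0.
exists d => // n s t st tst std.
pose J (i : 'I_n) := `]s i, t i[%classic.
pose D := \big[setU/set0]_(i < n) J i.
have mD : measurable D by apply: bigsetU_measurable => i _; exact: measurable_itv.
have muD : (mu D < d%:E)%E.
  by rewrite measure_disjoint_itvoo ?lte_fin// => i; case: (st i).
apply: le_lt_trans (dP D mD muD); rewrite -lee_fin.
have intS (A : set R) : measurable A -> mu.-integrable A (EFin \o f).
  by move=> mA; exact: integrableS intf.
have intSn (A : set R) : measurable A -> mu.-integrable A (EFin \o (fun x => `|f x|)).
  by move=> mA; exact/integrable_norm/intS.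
rewrite /Rintegral fineK; last by apply: integrable_fin_num => //; exact: intSn.
have mJ i : measurable (J i) by exact: measurable_itv.
have tJ : trivIset [set` index_enum 'I_n] J by exact: sub_trivIset tst.
have mfD : measurable_fun D (fun x => `|f x|%:E) := measurable_int _ (intSn _ mD).
rewrite /D (ge0_integral_bigsetU mu mJ (index_enum_uniq _) tJ mfD)//.
rewrite -sumEFin; apply: lee_sum => i _; case: (st i) => ls sit tr.
have finJ := @integrable_fin_num _ _ _ mu (J i) (mJ i) _ (intSn _ (mJ i)).
rewrite -[leRHS](fineK finJ) lee_fin.
have -> : fine (\int[mu]_(x in `[u, t i]) (f x)%:E) -
    fine (\int[mu]_(x in `[u, s i]) (f x)%:E) = \int[mu]_(x in J i) f x.
  rewrite /J Rintegral_itv_bndo_bndc; last exact: intS.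
  rewrite -(@Rintegral_itvB _ f (BLeft u))//; first exact: intS.
  by rewrite bnd_simp; lra.
exact: (@le_normr_Rintegral _ _ _ mu (J i) f (mJ i) (intS _ (mJ i))).
Qed.

(** The difference of [f] and the integral of [df] is absolutely continuous with derivative 0 almost
    everywhere, so monotonicity applied to it and to its opposite makes it constant. One-sided
    limits replace the values at [l] and [r], where [f] may be arbitrary. *)
Lemma abs_continuous_FTC l r f (df : R -> R) (A B : R) : l < r ->
  abs_continuous l r f ->
  {ae mu, forall x, x \in `]l, r[ -> is_derive x 1 f (df x)} ->
  mu.-integrable `[l, r] (EFin \o df) ->
  f x @[x --> l^'+] --> A -> f x @[x --> r^'-] --> B ->
  \int[mu]_(x in `[l, r]) df x = B - A.
Proof.
move=> lr acf fdf intdf fA fB.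
pose h := df \_ `[l, r].
have inth : mu.-integrable setT (EFin \o h).
  by rewrite -restrict_EFin; apply/integrable_restrict => //=; rewrite setTI.
have inthS (D : set R) : measurable D -> mu.-integrable D (EFin \o h).
  by move=> mD; exact: integrableS inth.
pose G x := \int[mu]_(t in `[l, x]) h t.
have acG : abs_continuous l r G by exact: abs_continuous_integral.
have Gh : {ae mu, forall x, x \in `]l, r[ -> is_derive x 1 G (df x)}.
  have := @FTC1 R h (BLeft l) (fun y => inthS _ (measurable_itv _))
    (integrable_locally (measurable_itv _) intdf).
  apply: lebesgue_aeS => x /= Gx xlr; have := xlr; rewrite in_itv/= => /andP[lx xr].
  have [|dG Ghx] := Gx; first by rewrite lte_fin.
  apply: DeriveDef => //; rewrite -derive1E Ghx /h patchE ifT//.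
  by rewrite inE/= in_itv/= !ltW.
have zero : {ae mu, forall x, x \in `]l, r[ -> is_derive x 1 (f - G) 0}.
  apply: lebesgue_aeS2 fdf Gh => x /= fx Gx xlr.
  have := fx xlr; have := Gx xlr => Hg Hf.
  by rewrite -[0](subrr (df x)); exact: is_deriveB.
have acfG : abs_continuous l r (f - G) by exact: abs_continuousB.
have le1 := @abs_continuous_le R l r (f - G) acfG.
have acGf : abs_continuous l r (G - f) by exact: abs_continuousB.
have le2 := @abs_continuous_le R l r (G - f) acGf.
pose m := (l + r) / 2; pose c := f m - G m.
have fE x : x \in `]l, r[ -> f x = G x + c.
  rewrite in_itv/= => /andP[lx xr].
  have {}le1 : forall x y, l < x -> x <= y -> y < r -> (f - G) x <= (f - G) y.
    apply: le1; apply: lebesgue_aeS zero => z /= zP zlr; exists 0 => //; exact: zP.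
  have {}le2 : forall x y, l < x -> x <= y -> y < r -> (G - f) x <= (G - f) y.
    apply: le2; apply: lebesgue_aeS zero => z /= zP zlr; exists 0 => //.
    rewrite -[G - f]opprK opprB -oppr0; apply: is_deriveN; exact: zP.
  have lm : l < m by rewrite /m; lra.
  have mr : m < r by rewrite /m; lra.
  rewrite /c; have [xm|/ltW mx] := leP x m.
    have := le1 _ _ lx xm mr; have := le2 _ _ lx xm mr.
    rewrite !fctE; lra.
  have := le1 _ _ lm mx xr; have := le2 _ _ lm mx xr.
  rewrite !fctE; lra.
have GA : G x @[x --> l^'+] --> (0 : R).
  apply: cvg_at_right_filter.
  exact: (@parameterized_integral_cvg_left _ l r h lr (inthS _ (measurable_itv _))).
have GB : G x @[x --> r^'-] --> \int[mu]_(x in `[l, r]) df x.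
  have -> : \int[mu]_(x in `[l, r]) df x = \int[mu]_(x in `[l, r]) h x.
    by apply: eq_Rintegral => x xlr; rewrite /h patchE xlr.
  exact: (@parameterized_integral_cvg_at_left _ l r h lr (inthS _ (measurable_itv _))).
have <- : c = A.
  apply: (@cvg_unique _ _ (f x @[x --> l^'+])) => //.
  have : G x + c @[x --> l^'+] --> 0 + c by apply: cvgD => //; exact: cvg_cst.
  rewrite add0r; apply: cvg_trans; apply: near_eq_cvg.
  near=> x; rewrite fE// in_itv/=; apply/andP; split; near: x.
    exact: nbhs_right_gt.
  exact: nbhs_right_lt.
have <- : \int[mu]_(x in `[l, r]) df x + c = B.
  apply: (@cvg_unique _ _ (f x @[x --> r^'-])) => //.
  have : G x + c @[x --> r^'-] --> \int[mu]_(x in `[l, r]) df x + c.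
    by apply: cvgD => //; exact: cvg_cst.
  apply: cvg_trans; apply: near_eq_cvg.
  near=> x; rewrite fE// in_itv/=; apply/andP; split; near: x.
    exact: nbhs_left_gt.
  exact: nbhs_left_lt.
by rewrite addrK.
Unshelve. all: by end_near. Qed.

End abs_continuous_theory.

(** * The linear boundary value problem *)

Section derive_helpers.
Variable R : realType.
Implicit Types (f g : R -> R) (x : R).
Notation mu := (@lebesgue_measure R).

Lemma is_derive_add f g x (a b : R) : is_derive x 1 f a -> is_derive x 1 g b ->
  is_derive x 1 (fun y => f y + g y) (a + b).
Proof. exact: is_deriveD. Qed.

Lemma is_derive_sub f g x (a b : R) : is_derive x 1 f a -> is_derive x 1 g b ->
  is_derive x 1 (fun y => f y - g y) (a - b).
Proof. exact: is_deriveB. Qed.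

Lemma is_derive_mul f g x (a b : R) : is_derive x 1 f a -> is_derive x 1 g b ->
  is_derive x 1 (fun y => f y * g y) (a * g x + f x * b).
Proof.
move=> fa gb; rewrite [a * g x + _]addrC [a * _]mulrC.
exact: (@is_deriveM R R f g x 1 a b fa gb).
Qed.

Lemma is_derive_scale f x (c a : R) : is_derive x 1 f a ->
  is_derive x 1 (fun y => c * f y) (c * a).
Proof. exact: is_deriveZ. Qed.

Lemma is_derive_continuous f x (a : R) : is_derive x 1 f a ->
  {for x, continuous f}.
Proof.
by case=> df _; apply/differentiable_continuous/derivable1_diffP.
Qed.

Lemma eq_in_is_derive f g (l r x a : R) : {in `]l, r[, f =1 g} ->
  x \in `]l, r[ -> is_derive x 1 g a -> is_derive x 1 f a.
Proof.
move=> fg xlr; apply: near_eq_is_derive.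
by near=> y; apply/esym/fg; near: y; exact: near_in_itvoo.
Unshelve. all: by end_near. Qed.

Lemma continuous_bounded_itv f (l r : R) : (forall x, {for x, continuous f}) ->
  exists M, forall x, x \in `[l, r] -> `|f x| <= M.
Proof.
move=> cf; have [rl|lr] := leP l r; last first.
  by exists 0 => x; rewrite in_itv/= => /andP[? ?]; lra.
have cnf : {within `[l, r], continuous (fun x => `|f x|)}.
  apply: continuous_subspaceT => x.
  exact: (@continuous_comp _ _ _ f (fun y : R => `|y|) _ (cf x) (@norm_continuous _ _ _)).
by have [c _ cmax] := EVT_max rl cnf; exists `|f c|.
Qed.

Lemma abs_continuous_C1 f (df : R -> R) (l r : R) :
  (forall x, is_derive x 1 f (df x)) -> (forall x, {for x, continuous df}) ->
  abs_continuous l r f.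
Proof.
move=> fdf cdf; have [M MP] := continuous_bounded_itv l r cdf.
apply: (@abs_continuous_derive _ l r f df M) => // x xlr; apply: MP.
exact: subset_itv_oo_cc xlr.
Qed.

Lemma cvg0_mulbound f g (F : set_system R) {FF : Filter F} (M : R) :
  f x @[x --> F] --> (0 : R) -> (\forall x \near F, `|g x| <= M) ->
  f x * g x @[x --> F] --> (0 : R).
Proof.
move=> f0 gM; apply/cvgrPdist_lt => e e0.
have K0 : 0 < `|M| + 1 by rewrite ltr_wpDl.
have eK : 0 < e / (`|M| + 1) by rewrite divr_gt0.
move/cvgrPdist_lt : f0 => /(_ _ eK) f0.
near=> x; rewrite sub0r normrN normrM.
have gx : `|g x| <= `|M| + 1.
  have : `|g x| <= M by near: x.
  by have := ler_norm M; lra.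
have : `|f x| < e / (`|M| + 1).
  by rewrite -normrN -sub0r; near: x.
rewrite ltr_pdivlMr// => h; apply: le_lt_trans h.
by rewrite ler_wpM2l.
Unshelve. all: by end_near. Qed.

Lemma in_L1_mul L f h : in_L1 L h -> (forall x, {for x, continuous f}) ->
  in_L1 L (fun x => f x * h x).
Proof.
move=> hL cf; have [M MP] := continuous_bounded_itv 0 L cf.
rewrite /in_L1 (_ : _ \o _ = ((EFin \o f) \* (EFin \o h))%E); last first.
  by apply/funext => x /=; rewrite EFinM.
apply: integrableMr => //.
  by apply: measurable_funTS; apply: continuous_measurable_fun.
exists M; split; first exact: num_real.
by move=> y My x /= xL; apply: le_trans (ltW My); apply: MP.
Qed.

End derive_helpers.

Section beam.
Variable R : realType.
Notation mu := (@lebesgue_measure R).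

(* w'''' - al w'' = h with w = w'' = 0 at both ends; w1, w2, w3 are the first
   three derivatives of w on ]0, L[. *)
Record beam (L al : R) (h w w1 w2 w3 : R -> R) : Prop := Beam {
  beam_d1 : forall x, x \in `]0, L[ -> is_derive x 1 w (w1 x);
  beam_d2 : forall x, x \in `]0, L[ -> is_derive x 1 w1 (w2 x);
  beam_d3 : forall x, x \in `]0, L[ -> is_derive x 1 w2 (w3 x);
  beam_ac : abs_continuous 0 L w3;
  beam_ae : {ae mu, forall x, x \in `]0, L[ ->
    is_derive x 1 w3 (h x + al * w2 x)};
  beam_L1 : in_L1 L h;
  beam_0 : w 0 = 0;
  beam_L : w L = 0;
  beam_cvg0 : w x @[x --> 0^'+] --> (0 : R);
  beam_cvgL : w x @[x --> L^'-] --> (0 : R);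
  beam_cvg20 : w2 x @[x --> 0^'+] --> (0 : R);
  beam_cvg2L : w2 x @[x --> L^'-] --> (0 : R) }.

Record smooth4 (g g1 g2 g3 g4 : R -> R) : Prop := Smooth4 {
  smooth_d1 : forall x : R, is_derive x 1 g (g1 x);
  smooth_d2 : forall x : R, is_derive x 1 g1 (g2 x);
  smooth_d3 : forall x : R, is_derive x 1 g2 (g3 x);
  smooth_d4 : forall x : R, is_derive x 1 g3 (g4 x) }.

(** The boundary term left by integrating by parts in the self-adjoint operator f'''' - al f''. With
    this grouping, each product has a factor that vanishes at a hinged end. *)
Definition lagrange_form (al : R) (g g1 g2 g3 w w1 w2 w3 : R -> R) (x : R) : R :=
  g x * w3 x - g1 x * w2 x + (g2 x - al * g x) * w1 x
  - (g3 x - al * g1 x) * w x.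

Section beam_theory.
Variables (L al : R) (h w w1 w2 w3 : R -> R).
Hypotheses (L0 : 0 < L) (wP : beam L al h w w1 w2 w3).

Let boundedP f (df : R -> R) :
  (forall x, x \in `]0, L[ -> is_derive x 1 f (df x)) ->
  abs_continuous 0 L df -> abs_continuous 0 L f.
Proof.
move=> fdf /abs_continuous_bounded[M MP]; exact: abs_continuous_derive fdf MP.
Qed.

Lemma beam_ac2 : abs_continuous 0 L w2.
Proof. exact: boundedP (beam_d3 wP) (beam_ac wP). Qed.

Lemma beam_ac1 : abs_continuous 0 L w1.
Proof. exact: boundedP (beam_d2 wP) beam_ac2. Qed.

Lemma beam_ac0 : abs_continuous 0 L w.
Proof. exact: boundedP (beam_d1 wP) beam_ac1. Qed.

Lemma beam_within : {within `[0, L], continuous w}.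
Proof.
apply: derivable_oo_LRcontinuous_within; split.
- by move=> x xL; case: (beam_d1 wP xL).
- by rewrite (beam_0 wP); exact: beam_cvg0 wP.
- by rewrite (beam_L wP); exact: beam_cvgL wP.
Qed.

Lemma beam_in_L1 : in_L1 L w.
Proof.
apply: continuous_compact_integrable; first exact: segment_compact.
exact: beam_within.
Qed.

(** * Lagrange's identity against smooth test functions *)

Section lagrange.
Variables (g g1 g2 g3 g4 : R -> R) (ka : R).
Hypotheses (gP : smooth4 g g1 g2 g3 g4) (gka : forall x, g4 x - al * g2 x = ka).

Let E := lagrange_form al g g1 g2 g3 w w1 w2 w3.

Let cg : forall x, {for x, continuous g}.
Proof. by move=> x; apply: is_derive_continuous; exact: smooth_d1 gP x. Qed.
Let cg1 : forall x, {for x, continuous g1}.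
Proof. by move=> x; apply: is_derive_continuous; exact: smooth_d2 gP x. Qed.
Let cg2 : forall x, {for x, continuous g2}.
Proof. by move=> x; apply: is_derive_continuous; exact: smooth_d3 gP x. Qed.
Let cg3 : forall x, {for x, continuous g3}.
Proof. by move=> x; apply: is_derive_continuous; exact: smooth_d4 gP x. Qed.

Let cmul (c : R) (f : R -> R) : (forall x, {for x, continuous f}) ->
  forall x, {for x, continuous (fun y => c * f y)}.
Proof. by move=> cf x; apply: cvgMr; exact: cf. Qed.

Let acg l r : abs_continuous l r g.
Proof. exact: abs_continuous_C1 (smooth_d1 gP) cg1. Qed.
Let acg1 l r : abs_continuous l r g1.
Proof. exact: abs_continuous_C1 (smooth_d2 gP) cg2. Qed.
Let acg2 l r : abs_continuous l r (fun x => g2 x - al * g x).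
Proof.
apply: (@abs_continuous_C1 _ _ (fun x => g3 x - al * g1 x)) => x.
  apply: is_derive_sub; first exact: smooth_d3 gP x.
  by apply: is_derive_scale; exact: smooth_d1 gP x.
by apply: cvgB; [exact: cg3|exact: cmul].
Qed.
Let acg3 l r : abs_continuous l r (fun x => g3 x - al * g1 x).
Proof.
apply: (@abs_continuous_C1 _ _ (fun x => g4 x - al * g2 x)) => x.
  apply: is_derive_sub; first exact: smooth_d4 gP x.
  by apply: is_derive_scale; exact: smooth_d2 gP x.
have -> : (fun x => g4 x - al * g2 x) = cst ka by apply/funext.
exact: cst_continuous.
Qed.

Lemma lagrange_form_ac : abs_continuous 0 L E.
Proof.
by rewrite /E /lagrange_form; apply: abs_continuousB; [apply: abs_continuousD;
  [apply: abs_continuousB|]|]; apply: abs_continuousM => //;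
  [exact: beam_ac wP|exact: beam_ac2|exact: beam_ac1|exact: beam_ac0].
Qed.

(* [lagrange_form] has derivative g (w'''' - al w'') - (g'''' - al g'') w. *)
Lemma lagrange_identity (l r A B : R) : 0 <= l -> l < r -> r <= L ->
  E x @[x --> l^'+] --> A -> E x @[x --> r^'-] --> B ->
  \int[mu]_(x in `[l, r]) (g x * h x - ka * w x) = B - A.
Proof.
move=> l0 lr rL EA EB.
have sub : `[l, r] `<=` `[0, L] by apply: subset_itv; rewrite bnd_simp.
have intgh : mu.-integrable `[l, r] (EFin \o (fun x => g x * h x - ka * w x)).
  apply: (@integrableS _ _ _ mu `[0, L]) => //.
  have i1 : in_L1 L (fun x => g x * h x) by exact: in_L1_mul (beam_L1 wP) cg.
  have i2 : in_L1 L (fun x => cst ka x * w x).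
    by apply: in_L1_mul beam_in_L1 _ => x; exact: cst_continuous.
  exact: (@integrableB _ _ _ mu _ (measurable_itv _) _ _ i1 i2).
apply: (abs_continuous_FTC lr _ _ intgh EA EB).
  exact: abs_continuousS lagrange_form_ac.
apply: lebesgue_aeS (beam_ae wP) => x /= w3x xlr.
have xL : x \in `]0, L[.
  by move: xlr; rewrite !in_itv/= => /andP[lx xr]; apply/andP; split; lra.
rewrite -(gka x).
(* The right-hand side is what the product rule yields for the four terms of [lagrange_form]; all
   the mixed products cancel. *)
have -> : g x * h x - (g4 x - al * g2 x) * w x =
   (g1 x * w3 x + g x * (h x + al * w2 x)) - (g2 x * w2 x + g1 x * w3 x)
   + ((g3 x - al * g1 x) * w1 x + (g2 x - al * g x) * w2 x)
   - ((g4 x - al * g2 x) * w x + (g3 x - al * g1 x) * w1 x) by ring.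
have [[d1 d2] [d3 d4]] := ((smooth_d1 gP x, smooth_d2 gP x),
  (smooth_d3 gP x, smooth_d4 gP x)).
rewrite /E /lagrange_form.
have dg3 : is_derive x 1 (fun y => g3 y - al * g1 y) (g4 x - al * g2 x).
  by apply: is_derive_sub => //; exact: is_derive_scale.
have dg2 : is_derive x 1 (fun y => g2 y - al * g y) (g3 x - al * g1 x).
  by apply: is_derive_sub => //; exact: is_derive_scale.
exact: is_derive_sub (is_derive_add (is_derive_sub (is_derive_mul d1 (w3x xL))
  (is_derive_mul d2 (beam_d3 wP xL))) (is_derive_mul dg2 (beam_d2 wP xL)))
  (is_derive_mul dg3 (beam_d1 wP xL)).
Qed.

Let cvg0_bound (F : set_system R) {FF : Filter F} f1 f2 :
  f1 x @[x --> F] --> (0 : R) -> (\forall x \near F, x \in `]0, L[) ->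
  abs_continuous 0 L f2 -> f1 x * f2 x @[x --> F] --> (0 : R).
Proof.
move=> f10 FL /abs_continuous_bounded[M MP]; apply: cvg0_mulbound f10 _.
by apply: filterS FL => x; exact: MP.
Qed.

(** Every product pairs a factor tending to 0 with an absolutely continuous, hence bounded, one. A
    general filter [F] covers both endpoints. *)
Let lagrange_cvg0 (F : set_system R) {FF : Filter F} (z : R) :
  g z = 0 -> g2 z = 0 -> F `=>` nbhs z -> (\forall x \near F, x \in `]0, L[) ->
  w x @[x --> F] --> (0 : R) -> w2 x @[x --> F] --> (0 : R) ->
  E x @[x --> F] --> (0 : R).
Proof.
move=> gz g2z Fz FL wF w2F; rewrite /E /lagrange_form.
have cF (f : R -> R) : {for z, continuous f} -> f z = 0 -> f x @[x --> F] --> (0 : R).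
  move=> cf fz; have : f x @[x --> z] --> f z by exact: cf.
  by rewrite fz; apply: cvg_trans => A; exact: Fz.
have gF := cF g (@cg z) gz.
have g2F : g2 x - al * g x @[x --> F] --> (0 : R).
  rewrite -(subr0 0); apply: cvgB.
    exact: (cF g2 (@cg2 z) g2z).
  by rewrite -(mulr0 al); apply: cvgMr.
rewrite -(subr0 0); apply: cvgB; last first.
  under eq_fun do rewrite mulrC.
  exact: (cvg0_bound wF FL (acg3 0 L)).
rewrite -(addr0 0); apply: cvgD; last exact: (cvg0_bound g2F FL beam_ac1).
rewrite -(subr0 0); apply: cvgB; first exact: (cvg0_bound gF FL (beam_ac wP)).
under eq_fun do rewrite mulrC.
exact: (cvg0_bound w2F FL (acg1 0 L)).
Qed.

Lemma lagrange_cvg_at0 : g 0 = 0 -> g2 0 = 0 -> E x @[x --> 0^'+] --> (0 : R).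
Proof.
move=> g0 g20; apply: (lagrange_cvg0 g0 g20).
- exact: cvg_within.
- near=> x; rewrite in_itv/=; apply/andP; split; near: x.
    exact: nbhs_right_gt.
  exact: nbhs_right_lt.
- exact: beam_cvg0 wP.
- exact: beam_cvg20 wP.
Unshelve. all: by end_near. Qed.

Lemma lagrange_cvg_atL : g L = 0 -> g2 L = 0 -> E x @[x --> L^'-] --> (0 : R).
Proof.
move=> gL g2L; apply: (lagrange_cvg0 gL g2L).
- exact: cvg_within.
- near=> x; rewrite in_itv/=; apply/andP; split; near: x.
    exact: nbhs_left_gt.
  exact: nbhs_left_lt.
- exact: beam_cvgL wP.
- exact: beam_cvg2L wP.
Unshelve. all: by end_near. Qed.

End lagrange.
End beam_theory.
End beam.

(** * Hyperbolic functions and the family of test functions *)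

Section hyperbolic.
Variable R : realType.
Implicit Types (x y k : R).

Lemma sinh0 : sinh (0 : R) = 0.
Proof. by rewrite /sinh oppr0 subrr mul0r. Qed.

Lemma cosh0 : cosh (0 : R) = 1.
Proof. by rewrite /cosh oppr0 expR0; field. Qed.

Lemma sinhD x y : sinh (x + y) = sinh x * cosh y + cosh x * sinh y.
Proof. by rewrite /sinh /cosh opprD !expRD; field. Qed.

Lemma coshD x y : cosh (x + y) = cosh x * cosh y + sinh x * sinh y.
Proof. by rewrite /sinh /cosh opprD !expRD; field. Qed.

Lemma sinhN x : sinh (- x) = - sinh x.
Proof. by rewrite /sinh opprK; field. Qed.

Lemma coshN x : cosh (- x) = cosh x.
Proof. by rewrite /cosh opprK addrC. Qed.

Lemma sinhB x y : sinh (x - y) = sinh x * cosh y - cosh x * sinh y.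
Proof. by rewrite sinhD sinhN coshN mulrN. Qed.

Lemma coshB x y : cosh (x - y) = cosh x * cosh y - sinh x * sinh y.
Proof. by rewrite coshD sinhN coshN mulrN. Qed.

Lemma cosh_gt0 x : 0 < cosh x.
Proof. by rewrite /cosh divr_gt0// addr_gt0// expR_gt0. Qed.

Lemma sinh_gt0 x : 0 < x -> 0 < sinh x.
Proof. by move=> x0; rewrite /sinh divr_gt0// subr_gt0 ltr_expR; lra. Qed.

Lemma cosh2_sinh2 x : cosh x ^+ 2 - sinh x ^+ 2 = 1.
Proof. by rewrite !expr2 -coshB subrr cosh0. Qed.

Lemma is_derive_expRM x k : is_derive x 1 (fun y => expR (k * y)) (k * expR (k * x)).
Proof.
have -> : k * expR (k * x) = expR (k * x) * (k * 1) by rewrite mulr1 mulrC.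
have kx : is_derive x (1 : R) (fun y => k * y) (k * 1).
  by apply: is_derive_scale; exact: is_derive_id.
exact: (@is_derive1_comp _ expR (fun y => k * y) x _ _ (is_derive_expR _) kx).
Qed.

Lemma is_derive_sinhM x k : is_derive x 1 (fun y => sinh (k * y)) (k * cosh (k * x)).
Proof.
have -> : (fun y => sinh (k * y)) =
    (fun y => 2^-1 * (expR (k * y) - expR (- k * y))).
  by apply/funext => y; rewrite /sinh mulNr mulrC.
apply: (is_derive_eq (is_derive_scale 2^-1
  (is_derive_sub (is_derive_expRM x k) (is_derive_expRM x (- k))))).
by rewrite /cosh !mulNr; field.
Qed.

Lemma is_derive_coshM x k : is_derive x 1 (fun y => cosh (k * y)) (k * sinh (k * x)).
Proof.
have -> : (fun y => cosh (k * y)) =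
    (fun y => 2^-1 * (expR (k * y) + expR (- k * y))).
  by apply/funext => y; rewrite /cosh mulNr mulrC.
apply: (is_derive_eq (is_derive_scale 2^-1
  (is_derive_add (is_derive_expRM x k) (is_derive_expRM x (- k))))).
by rewrite /sinh !mulNr; field.
Qed.

(* A family closed under differentiation that contains every test function. *)
Definition polyhyp (k p q r A B x : R) : R :=
  p + q * x + r * (x * x) + A * sinh (k * x) + B * cosh (k * x).

Lemma is_derive_polyhyp k p q r A B x :
  is_derive x 1 (polyhyp k p q r A B) (polyhyp k q (2 * r) 0 (B * k) (A * k) x).
Proof.
have did : is_derive x (1 : R) (fun y : R => y) 1 by exact: is_derive_id.
have dp : is_derive x (1 : R) (fun _ : R => p) 0 by exact: is_derive_cst.
apply: (is_derive_eq (is_derive_add (is_derive_add (is_derive_add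
  (is_derive_add dp (is_derive_scale q did))
  (is_derive_scale r (is_derive_mul did did)))
  (is_derive_scale A (is_derive_sinhM x k)))
  (is_derive_scale B (is_derive_coshM x k)))).
by rewrite /polyhyp; ring.
Qed.

Lemma smooth4_polyhyp k p q r A B :
  smooth4 (polyhyp k p q r A B) (polyhyp k q (2 * r) 0 (B * k) (A * k))
    (polyhyp k (2 * r) 0 0 (A * k * k) (B * k * k))
    (polyhyp k 0 0 0 (B * k * k * k) (A * k * k * k))
    (polyhyp k 0 0 0 (A * k * k * k * k) (B * k * k * k * k)).
Proof.
split=> x; [exact: is_derive_polyhyp| | |];
  apply: (is_derive_eq (is_derive_polyhyp _ _ _ _ _ _ _));
  by rewrite /polyhyp; ring.
Qed.

End hyperbolic.

(** * Representation of solutions by the Green function *)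

Section green_representation.
Variable R : realType.
Notation mu := (@lebesgue_measure R).
Variables (L a : R).
Hypotheses (L0 : 0 < L) (a0 : 0 < a).
Let k := Num.sqrt a.
Let k0 : 0 < k. Proof. by rewrite sqrtr_gt0. Qed.
Let kk : k * k = a. Proof. by rewrite -expr2 sqr_sqrtr// ltW. Qed.
Let sL0 : 0 < sinh (k * L). Proof. by rewrite sinh_gt0// mulr_gt0. Qed.

(** [lo x] and [hi x] are the branches of the Green function in the variable s, for s <= x and for x
    <= s. As members of [polyhyp] they come with their four derivatives. *)
Let lo x := polyhyp k 0 ((L - x) / (a * L)) 0
  (- (sinh (k * (L - x)) / (a * k * sinh (k * L)))) 0.
Let hi x := polyhyp k (x / a) (- (x / (a * L))) 0
  (sinh (k * x) / (a * k * sinh (k * L)) * cosh (k * L))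
  (- (sinh (k * x) / (a * k))).

Let loE x s : lo x s = green_below L a s x.
Proof.
rewrite /lo /polyhyp /green_below -/k; field.
by rewrite !gt_eqF//.
Qed.

Let hiE x s : hi x s = green_below L a x s.
Proof.
rewrite /hi /polyhyp /green_below -/k [k * (L - s)]mulrBr sinhB; field.
by rewrite !gt_eqF//.
Qed.

Lemma green_continuous x s : {for s, continuous (green L a x)}.
Proof.
(* On either side of [x] one of the first two terms is frozen at its value at [x]. That value is
   [hi x x] for both branches, so the subtraction removes it. *)
have -> : green L a x = (fun s => lo x (Num.min x s) + hi x (Num.max x s) - hi x x).
  by apply/funext => t; rewrite /green; case: leP => _; rewrite !(loE, hiE); ring.
have cx : {for s, continuous (fun _ : R => x)} by exact: cst_continuous.
have cid : {for s, continuous (fun t : R => t)} by exact: cvg_id.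
have cmin := continuous_min cx cid; have cmax := continuous_max cx cid.
have cpoly p q r A B z : {for z, continuous (polyhyp k p q r A B)}.
  exact: is_derive_continuous (is_derive_polyhyp _ _ _ _ _ _ _).
apply: cvgB; last exact: cvg_cst.
apply: cvgD.
  exact: (@continuous_comp _ _ _ _ (lo x) s cmin (cpoly _ _ _ _ _ _)).
exact: (@continuous_comp _ _ _ _ (hi x) s cmax (cpoly _ _ _ _ _ _)).
Qed.

(** Lagrange's identity is applied to [lo x] on [0, x] and to [hi x] on [x, L]. The outer boundary
    terms vanish; at [x] the two branches agree up to the second derivative, and the unit jump of
    the third leaves exactly [w x]. *)
Lemma green_representation h w w1 w2 w3 : beam L a h w w1 w2 w3 ->
  forall x, x \in `[0, L] -> w x = integ L (fun s => green L a x s * h s).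
Proof.
move=> wP x; rewrite in_itv/= => /andP[].
have zero f : (forall s, s \in `[0, L] -> f s = 0) -> integ L f = 0.
  move=> f0; transitivity (\int[mu]_(s in `[0, L]) (0 : R)).
    by apply: eq_Rintegral => s; rewrite inE => sL; exact: f0.
  by rewrite Rintegral_cst// mul0r.
(* The endpoints are treated apart, since one of the two intervals would degenerate; there the
   kernel itself vanishes. *)
rewrite le_eqVlt => /predU1P[<- _|x0].
  rewrite (beam_0 wP) zero// => s; rewrite in_itv/= => /andP[s0 sL].
  by rewrite /green s0 /green_below mulr0 sinh0 !mul0r subr0 mul0r.
rewrite le_eqVlt => /predU1P[->|xL].
  rewrite (beam_L wP) zero// => s; rewrite in_itv/= => /andP[s0 sL].
  rewrite /green; case: ifPn => Ls.
    have -> : s = L by apply/eqP; rewrite eq_le sL.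
    by rewrite /green_below subrr !mulr0 sinh0 mulr0 !mul0r subrr mul0r.
  by rewrite /green_below subrr !mulr0 sinh0 mulr0 !mul0r subrr mul0r.
have xin : x \in `]0, L[ by rewrite in_itv/= x0.
have lP := smooth4_polyhyp k 0 ((L - x) / (a * L)) 0
  (- (sinh (k * (L - x)) / (a * k * sinh (k * L)))) 0.
have hP := smooth4_polyhyp k (x / a) (- (x / (a * L))) 0
  (sinh (k * x) / (a * k * sinh (k * L)) * cosh (k * L))
  (- (sinh (k * x) / (a * k))).
rewrite -/(lo x) in lP; rewrite -/(hi x) in hP.
set l1 := polyhyp _ _ _ _ _ _ in lP; set l2 := polyhyp _ _ _ _ _ _ in lP.
set l3 := polyhyp _ _ _ _ _ _ in lP; set l4 := polyhyp _ _ _ _ _ _ in lP.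
set h1 := polyhyp _ _ _ _ _ _ in hP; set h2 := polyhyp _ _ _ _ _ _ in hP.
set h3 := polyhyp _ _ _ _ _ _ in hP; set h4 := polyhyp _ _ _ _ _ _ in hP.
have lk s : l4 s - a * l2 s = 0 by rewrite /l4 /l2 /polyhyp -kk; ring.
have hk s : h4 s - a * h2 s = 0 by rewrite /h4 /h2 /polyhyp -kk; ring.
have cont g g1 g2 g3 g4 : smooth4 g g1 g2 g3 g4 ->
    (forall s, g4 s - a * g2 s = 0) ->
    {for x, continuous (lagrange_form a g g1 g2 g3 w w1 w2 w3)}.
  move=> gP gk; have acE := lagrange_form_ac wP gP gk.
  exact: abs_continuous_continuous acE _ xin.
have lo0 : lo x 0 = 0 by rewrite /lo /polyhyp !mulr0 sinh0; ring.
have l20 : l2 0 = 0 by rewrite /l2 /polyhyp !mulr0 sinh0; ring.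
have hiL : hi x L = 0 by rewrite hiE /green_below subrr !mulr0 sinh0; ring.
have h2L : h2 L = 0 by rewrite /h2 /polyhyp; field; rewrite !gt_eqF.
have intlo := lagrange_identity wP lP lk (lexx 0) x0 (ltW xL)
  (lagrange_cvg_at0 L0 wP lP lk lo0 l20)
  (cvg_at_left_filter (cont _ _ _ _ _ lP lk)).
have inthi := lagrange_identity wP hP hk (ltW x0) xL (lexx L)
  (cvg_at_right_filter (cont _ _ _ _ _ hP hk))
  (lagrange_cvg_atL L0 wP hP hk hiL h2L).
have intg : in_L1 L (fun s => green L a x s * h s).
  by apply: in_L1_mul; [exact: beam_L1 wP|exact: green_continuous].
have -> : integ L (fun s => green L a x s * h s) =
    \int[mu]_(s in `[0, x]) (lo x s * h s - 0 * w s) +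
    \int[mu]_(s in `[x, L]) (hi x s * h s - 0 * w s).
  rewrite -[LHS](subrK (\int[mu]_(s in `[0, x]) (green L a x s * h s))) addrC.
  congr (_ + _).
    apply: eq_Rintegral => s; rewrite inE/= in_itv/= => /andP[s0 sx].
    rewrite mul0r subr0 loE /green; case: ifPn => // xs.
    by have -> : s = x by apply/eqP; rewrite eq_le sx.
  rewrite /integ Rintegral_itvB//; [|by rewrite bnd_simp ltW..].
  rewrite Rintegral_itv_obnd_cbnd; last first.
    by apply: integrableS intg => //; apply: subset_itv; rewrite bnd_simp// ltW.
  apply: eq_Rintegral => s; rewrite inE/= in_itv/= => /andP[xs sL].
  by rewrite mul0r subr0 hiE /green xs.
rewrite intlo inthi /lagrange_form.
have e0 : lo x x = hi x x by rewrite loE hiE.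
have cs := cosh2_sinh2 (k * x).
have e1 : l1 x = h1 x.
  (* The mismatch is displayed as a multiple of 1 - (cosh^2 - sinh^2), because field arithmetic
     alone does not know the hyperbolic identity. *)
  have e : l1 x - h1 x = (1 - (cosh (k * x) ^+ 2 - sinh (k * x) ^+ 2)) / a.
    rewrite /l1 /h1 /polyhyp [k * (L - x)]mulrBr sinhB; field.
    by rewrite !gt_eqF.
  by apply/eqP; rewrite -subr_eq0 e cs subrr mul0r.
have e2 : l2 x = h2 x.
  rewrite /l2 /h2 /polyhyp [k * (L - x)]mulrBr sinhB; field.
  by rewrite !gt_eqF.
have e3 : l3 x = h3 x - 1.
  have e : l3 x - h3 x = - (k * k / a) * (cosh (k * x) ^+ 2 - sinh (k * x) ^+ 2).
    rewrite /l3 /h3 /polyhyp [k * (L - x)]mulrBr sinhB; field.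
    by rewrite !gt_eqF.
  by rewrite -[l3 x](subrK (h3 x)) e cs kk divff ?gt_eqF// mulr1 addrC.
rewrite e0 e1 e2 e3; ring.
Qed.

End green_representation.

(** * Existence for the linear problem *)

Section beam_existence.
Variable R : realType.
Notation mu := (@lebesgue_measure R).

Lemma antiderivative (u v u' v' : R) (f : R -> R) :
  (forall x, x \in `]u, v[ -> {for x, continuous f}) -> u < u' -> v' < v ->
  exists F : R -> R, forall x, x \in `]u', v'[ -> is_derive x 1 F (f x).
Proof.
move=> cf uu vv; exists (fun x => \int[mu]_(t in `[u', x]) f t) => x.
rewrite in_itv/= => /andP[ux xv].
have sub z : z \in `[u', v'] -> z \in `]u, v[.
  by rewrite !in_itv/= => /andP[uz zv]; apply/andP; split; lra.
have intf : mu.-integrable `[u', v'] (EFin \o f).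
  apply: continuous_compact_integrable; first exact: segment_compact.
  by apply: continuous_in_subspaceT => z; rewrite inE => /sub; exact: cf.
have cfx : {for x, continuous f} by apply/cf/sub; rewrite in_itv/= !ltW.
have [dF Fx] := continuous_FTC1_closed xv intf ux cfx.
by apply: (DeriveDef dF); rewrite -derive1E; exact: Fx.
Qed.

(* w'' = Z solves Z'' = a Z + phi. Variation of constants is applied to the
   continuous primitive F of phi instead of phi, so that Z is of class C^1. *)
Lemma beam_exists (L a : R) phi : 0 < L -> 0 < a -> in_L1 L phi ->
  exists w w1 w2 w3, beam L a phi w w1 w2 w3.
Proof.
move=> L0 a0 phi1.
(* Each antiderivative shortens the interval of validity by one unit at both ends, from ]-5, L + 5[
   for [F] down to ]-2, L + 2[ for [Z2]. The points 0 and L stay interior, so the boundary limits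
   follow from continuity. *)
have I0 : (0 : R) \in `]- 2, (L + 2)[ by rewrite in_itv/=; apply/andP; split; lra.
have IL : L \in `]- 2, (L + 2)[ by rewrite in_itv/=; apply/andP; split; lra.
have I13 (x : R) : x \in `]- 2, (L + 2)[ -> x \in `]- 4, (L + 4)[.
  by rewrite !in_itv/= => /andP[? ?]; apply/andP; split; lra.
have I12 (x : R) : x \in `]- 2, (L + 2)[ -> x \in `]- 3, (L + 3)[.
  by rewrite !in_itv/= => /andP[? ?]; apply/andP; split; lra.
have I01 (x : R) : x \in `]0, L[ -> x \in `]- 2, (L + 2)[.
  by rewrite !in_itv/= => /andP[? ?]; apply/andP; split; lra.
pose k := Num.sqrt a.
have k0 : 0 < k by rewrite sqrtr_gt0.
have kk : k * k = a by rewrite -expr2 sqr_sqrtr// ltW.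
have sL0 : 0 < sinh (k * L) by rewrite sinh_gt0// mulr_gt0.
pose f := phi \_ `[0, L].
have intf : mu.-integrable setT (EFin \o f).
  by rewrite -restrict_EFin; apply/integrable_restrict => //=; rewrite setTI.
pose F (x : R) := \int[mu]_(t in `[- 5, x]) f t.
have acF l r : - 5 <= l -> abs_continuous l r F.
  by move=> l4; exact: abs_continuous_integral.
have acF0 : abs_continuous 0 L F by apply: acF; lra.
have cF (x : R) : x \in `]- 5, (L + 5)[ -> {for x, continuous F}.
  by move=> xI; exact: (abs_continuous_continuous (acF (- 5) (L + 5) (lexx _))).
have Fphi : {ae mu, forall x, x \in `]0, L[ -> is_derive x 1 F (phi x)}.
  have intfS (D : set R) : measurable D -> mu.-integrable D (EFin \o f).
    by move=> mD; exact: integrableS intf.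
  have := @FTC1 R f (BLeft (- 5)) (fun y => intfS _ (measurable_itv _))
    (integrable_locally (measurable_itv _) phi1).
  apply: lebesgue_aeS => x /= Fx xL; have := xL; rewrite in_itv/= => /andP[x0 xL'].
  have [|dF Fxf] := Fx; first by rewrite lte_fin; lra.
  apply: DeriveDef => //; rewrite -derive1E Fxf /f patchE ifT//.
  by rewrite inE/= in_itv/= !ltW.
pose ch (x : R) := cosh (k * x); pose sh (x : R) := sinh (k * x).
have dch (x : R) : is_derive x 1 ch (k * sh x) by exact: is_derive_coshM.
have dsh (x : R) : is_derive x 1 sh (k * ch x) by exact: is_derive_sinhM.
have cch (x : R) : {for x, continuous ch} by exact: is_derive_continuous (dch x).
have csh (x : R) : {for x, continuous sh} by exact: is_derive_continuous (dsh x).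
have [P dP] : exists P : R -> R, forall x, x \in `]- 4, (L + 4)[ ->
    is_derive x 1 P (ch x * F x).
  apply: (@antiderivative (- 5) (L + 5)); [|lra|lra].
  by move=> x xI; apply: cvgM; [exact: cch|exact: cF].
have [Q dQ] : exists Q : R -> R, forall x, x \in `]- 4, (L + 4)[ ->
    is_derive x 1 Q (sh x * F x).
  apply: (@antiderivative (- 5) (L + 5)); [|lra|lra].
  by move=> x xI; apply: cvgM; [exact: csh|exact: cF].
(* [A] enforces Z(0) = 0 and [B] enforces Z(L) = 0; the latter divides by [sh L], which is
   positive. *)
pose A := - P 0; pose B := ch L * (P L + A) / sh L - Q L.
pose Z (x : R) := ch x * (P x + A) - sh x * (Q x + B).
(* [V] is the part of Z' free of [F]: in Z' the terms in [F] add up to F (cosh^2 - sinh^2) = F, and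
   in V' they cancel. Hence Z' = F + V and V' = a Z, which gives Z'' = phi + a Z almost
   everywhere. *)
pose V (x : R) := k * (sh x * (P x + A) - ch x * (Q x + B)).
have dPA (x : R) : x \in `]- 4, (L + 4)[ -> is_derive x 1 (fun y => P y + A) (ch x * F x).
  move=> xI; rewrite -[ch x * F x]addr0.
  exact: is_derive_add (dP x xI) (is_derive_cst A x 1).
have dQB (x : R) : x \in `]- 4, (L + 4)[ -> is_derive x 1 (fun y => Q y + B) (sh x * F x).
  move=> xI; rewrite -[sh x * F x]addr0.
  exact: is_derive_add (dQ x xI) (is_derive_cst B x 1).
have cs (x : R) : ch x * ch x - sh x * sh x = 1 by rewrite -!expr2 cosh2_sinh2.
have dZ (x : R) : x \in `]- 4, (L + 4)[ -> is_derive x 1 Z (F x + V x).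
  move=> xI; apply: (is_derive_eq (is_derive_sub (is_derive_mul (dch x) (dPA x xI))
    (is_derive_mul (dsh x) (dQB x xI)))).
  by rewrite -[in RHS](mul1r (F x)) -(cs x) /V; ring.
have dV (x : R) : x \in `]- 4, (L + 4)[ -> is_derive x 1 V (a * Z x).
  move=> xI; apply: (is_derive_eq (is_derive_scale k (is_derive_sub
    (is_derive_mul (dsh x) (dPA x xI)) (is_derive_mul (dch x) (dQB x xI))))).
  by rewrite -kk /Z; ring.
have [Z1 dZ1] : exists Z1 : R -> R, forall x, x \in `]- 3, (L + 3)[ ->
    is_derive x 1 Z1 (Z x).
  apply: (@antiderivative (- 4) (L + 4)); [|lra|lra].
  by move=> x /dZ/is_derive_continuous.
have [Z2 dZ2] : exists Z2 : R -> R, forall x, x \in `]- 2, (L + 2)[ ->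
    is_derive x 1 Z2 (Z1 x).
  apply: (@antiderivative (- 3) (L + 3)); [|lra|lra].
  by move=> x /dZ1/is_derive_continuous.
(* Subtracting the chord of [Z2] makes both boundary values 0 and leaves the second derivative
   unchanged. *)
pose m := (Z2 L - Z2 0) / L.
pose w (x : R) := Z2 x - (Z2 0 + m * x).
have dw (x : R) : x \in `]- 2, (L + 2)[ -> is_derive x 1 w (Z1 x - m).
  move=> xI; have did : is_derive x (1 : R) (fun y : R => y) 1 by exact: is_derive_id.
  have dc : is_derive x (1 : R) (fun _ : R => Z2 0) 0 by exact: is_derive_cst.
  apply: (is_derive_eq (is_derive_sub (dZ2 x xI)
    (is_derive_add dc (is_derive_scale m did)))).
  by rewrite add0r mulr1.
have w0 : w 0 = 0 by rewrite /w; ring.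
have wL : w L = 0 by rewrite /w /m; field; rewrite gt_eqF.
have Z0 : Z 0 = 0 by rewrite /Z /sh mulr0 sinh0 /A; ring.
have ZL : Z L = 0 by rewrite /Z /B; field; rewrite gt_eqF.
have lim (g : R -> R) (dg x : R) : is_derive x 1 g dg -> g x = 0 ->
    g y @[y --> x] --> (0 : R).
  by move=> /is_derive_continuous cg gx; rewrite -gx; exact: cg.
exists w, (fun x => Z1 x - m), Z, (fun x => F x + V x); split.
- by move=> x /I01; exact: dw.
- move=> x /I01/I12 xI; rewrite -[Z x]subr0.
  exact: is_derive_sub (dZ1 x xI) (is_derive_cst m x 1).
- by move=> x /I01/I13; exact: dZ.
- apply: abs_continuousD => //.
  have ac_ch : abs_continuous 0 L ch.
    by apply: abs_continuous_C1 dch _ => x; apply: cvgMr; exact: csh.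
  have ac_sh : abs_continuous 0 L sh.
    by apply: abs_continuous_C1 dsh _ => x; apply: cvgMr; exact: cch.
  have ac_int g (dg : R -> R) : abs_continuous 0 L dg ->
      (forall x, x \in `]- 4, (L + 4)[ -> is_derive x 1 g (dg x)) ->
      abs_continuous 0 L g.
    move=> /abs_continuous_bounded[M MP] gdg.
    have gd x (xL : x \in `]0, L[) := gdg x (I13 x (I01 x xL)).
    exact: (abs_continuous_derive gd MP).
  have acPA := ac_int _ _ (abs_continuousM ac_ch acF0) dPA.
  have acQB := ac_int _ _ (abs_continuousM ac_sh acF0) dQB.
  have acZ := abs_continuousB (abs_continuousM ac_ch acPA)
    (abs_continuousM ac_sh acQB).
  apply: (ac_int _ _ _ dV); apply: abs_continuousM => //.
  by apply: (@abs_continuous_lip _ _ _ _ 0) => x y _ _ _; rewrite subrr normr0 mul0r.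
- apply: lebesgue_aeS Fphi => x /= Fx xL.
  exact: is_derive_add (Fx xL) (dV x (I13 x (I01 x xL))).
- exact: phi1.
- exact: w0.
- exact: wL.
- by apply: cvg_at_right_filter; exact: lim (dw _ I0) w0.
- by apply: cvg_at_left_filter; exact: lim (dw _ IL) wL.
- by apply: cvg_at_right_filter; exact: lim (dZ _ (I13 _ I0)) Z0.
- by apply: cvg_at_left_filter; exact: lim (dZ _ (I13 _ IL)) ZL.
Qed.

End beam_existence.

Section beam_misc.
Variable R : realType.
Notation mu := (@lebesgue_measure R).

Lemma cvg0_sub_scale (F : set_system R) {FF : Filter F} (f g : R -> R) (s : R) :
  f x @[x --> F] --> (0 : R) -> g x @[x --> F] --> (0 : R) ->
  f x - s * g x @[x --> F] --> (0 : R).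
Proof.
move=> f0 g0; have : f x - s * g x @[x --> F] --> (0 - s * 0 : R).
  by apply: cvgB f0 _; exact: cvgMr.
by rewrite mulr0 subr0.
Qed.

(** Shaped for S phi, which is the solution with load phi minus a multiple of the solution with load
    1. *)
Lemma beam_sub L a (s : R) h w w1 w2 w3 h' w' w1' w2' w3' :
  beam L a h w w1 w2 w3 -> beam L a h' w' w1' w2' w3' ->
  beam L a (fun x => h x - s * h' x) (fun x => w x - s * w' x)
   (fun x => w1 x - s * w1' x) (fun x => w2 x - s * w2' x)
   (fun x => w3 x - s * w3' x).
Proof.
move=> wP wP'.
have der (f g : R -> R) (x df dg : R) : is_derive x 1 f df -> is_derive x 1 g dg ->
    is_derive x 1 (fun y => f y - s * g y) (df - s * dg).
  by move=> fx gx; exact: is_derive_sub fx (is_derive_scale s gx).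
split.
- by move=> x xL; exact: der (beam_d1 wP xL) (beam_d1 wP' xL).
- by move=> x xL; exact: der (beam_d2 wP xL) (beam_d2 wP' xL).
- by move=> x xL; exact: der (beam_d3 wP xL) (beam_d3 wP' xL).
- apply: abs_continuousB; first exact: beam_ac wP.
  apply: abs_continuousM (beam_ac wP').
  by apply: (@abs_continuous_lip _ _ _ _ 0) => x y _ _ _; rewrite subrr normr0 mul0r.
- apply: lebesgue_aeS2 (beam_ae wP) (beam_ae wP') => x /= d1 d2 xL.
  by apply: (is_derive_eq (der _ _ _ _ _ (d1 xL) (d2 xL))); ring.
- have i' : in_L1 L (fun x => cst s x * h' x).
    by apply: in_L1_mul (beam_L1 wP') _ => x; exact: cst_continuous.
  exact: (@integrableB _ _ _ mu _ (measurable_itv _) _ _ (beam_L1 wP) i').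
- by rewrite (beam_0 wP) (beam_0 wP') mulr0 subr0.
- by rewrite (beam_L wP) (beam_L wP') mulr0 subr0.
- exact: cvg0_sub_scale (beam_cvg0 wP) (beam_cvg0 wP').
- exact: cvg0_sub_scale (beam_cvgL wP) (beam_cvgL wP').
- exact: cvg0_sub_scale (beam_cvg20 wP) (beam_cvg20 wP').
- exact: cvg0_sub_scale (beam_cvg2L wP) (beam_cvg2L wP').
Qed.

Lemma in_L1_cst L (c : R) : in_L1 L (fun _ => c).
Proof.
apply: continuous_compact_integrable; first exact: segment_compact.
by apply: continuous_subspaceT => x; exact: cst_continuous.
Qed.

Lemma in_L1_sub L f g : in_L1 L f -> in_L1 L g -> in_L1 L (fun x : R => f x - g x).
Proof.
by move=> fL gL; exact: (@integrableB _ _ _ mu _ (measurable_itv _) _ _ fL gL).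
Qed.

(** Once [integ L w] is frozen as a number the problem is linear: it shifts the coefficient [a] and
    adds a constant load. *)
Lemma bvp_beam (L a b c : R) p w : in_L1 L p -> W41 L w -> bvp_solution L a b c p w ->
  exists w1 w2 w3,
    beam L (a + b * integ L w) (fun x => p x - c * integ L w) w w1 w2 w3.
Proof.
move=> pL [[wd w0 wL] wd12 acw3 ae3 w4L] [eqw w00 wLL w20 w2L].
exists w^`()%classic, w^`(2)%classic, w^`(3)%classic.
have alg (u v q y : R) : u - (a + b * q) * v + c * q = y ->
    u = y - c * q + (a + b * q) * v by move=> <-; ring.
have der (f : R -> R) (x : R) : derivable f x 1 -> is_derive x 1 f (f^`()%classic x).
  by move=> /derivableP; rewrite derive1E.
split.
- by move=> x xL; exact: der (wd x xL).
- by move=> x xL; case: (wd12 x xL) => /der.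
- by move=> x xL; case: (wd12 x xL) => _ /der.
- exact: acw3.
- apply: lebesgue_aeS2 eqw ae3 => x /= e d xL.
  exact: (is_derive_eq (der _ _ (d xL)) (alg _ _ _ _ (e xL))).
- exact: in_L1_sub pL (in_L1_cst _ _).
- exact: w00.
- exact: wLL.
- by move: w0; rewrite w00.
- by move: wL; rewrite wLL.
- exact: w20.
- exact: w2L.
Qed.

End beam_misc.

(** * Comparison of the resolvents *)

Section maximum_principle.
Variable R : realType.

(** At a negative interior minimum [c] the first derivative vanishes, while f'' <= ka f < 0 just to
    the right of [c]. Two applications of the mean value theorem make [f] drop below its minimum;
    continuity of [f2] is never involved. *)
Lemma maximum_principle (L ka : R) (f f1 f2 : R -> R) : 0 < L -> 0 < ka ->
  (forall x : R, is_derive x 1 f (f1 x)) -> (forall x : R, is_derive x 1 f1 (f2 x)) ->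
  (forall x, x \in `]0, L[ -> f2 x <= ka * f x) -> 0 <= f 0 -> 0 <= f L ->
  forall x, x \in `[0, L] -> 0 <= f x.
Proof.
move=> L0 ka0 df df1 f2f f00 fL0.
have cf x : {for x, continuous f} by exact: is_derive_continuous (df x).
have cf1 x : {for x, continuous f1} by exact: is_derive_continuous (df1 x).
have wf u v : {within `[u, v], continuous f} by exact: continuous_subspaceT.
have wf1 u v : {within `[u, v], continuous f1} by exact: continuous_subspaceT.
have [c cL cmin] := EVT_min (ltW L0) (wf 0 L).
suff fc : 0 <= f c by move=> x /cmin; exact: le_trans.
rewrite leNgt; apply/negP => fc0.
have [c0 c1] : 0 < c /\ c < L.
  move: cL; rewrite in_itv/= => /andP[c0 c1]; split; rewrite lt_neqAle ?c0 ?c1 andbT.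
    by apply: contraTneq fc0 => <-; rewrite -leNgt.
  by apply: contraTneq fc0 => ->; rewrite -leNgt.
have f1c : f1 c = 0.
  have H : is_derive c 1 f 0.
    have cI : c \in `]0, L[ by rewrite in_itv/= c0 c1.
    have dfI (t : R) : t \in `]0, L[ -> derivable f t 1 by move=> _; case: (df t).
    apply: (derive1_at_min (ltW L0) dfI cI) => t tL.
    by apply: cmin; exact: subset_itv_oo_cc tL.
  by case: (df c) => _ <-; case: H.
have [d [cd dL fneg]] : exists d, [/\ c < d, d < L & forall y, c <= y -> y <= d -> f y < 0].
  have /cvgrPdist_lt/(_ _ (_ : 0 < - f c)) : f x @[x --> c] --> f c by exact: cf.
  rewrite oppr_gt0 => /(_ fc0) [e /= e0 eP].
  exists (c + Num.min (e / 2) ((L - c) / 2)).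
  have m0 : 0 < Num.min (e / 2) ((L - c) / 2) by rewrite lt_min; apply/andP; split; lra.
  have me : Num.min (e / 2) ((L - c) / 2) <= e / 2 by rewrite ge_min lexx.
  have mL : Num.min (e / 2) ((L - c) / 2) <= (L - c) / 2 by rewrite ge_min lexx orbT.
  split; [lra|lra|] => y cy yd.
  have yc : `|c - y| < e by rewrite distrC ger0_norm ?subr_ge0//; lra.
  have := eP y yc; have := ler_norm (f y - f c); rewrite distrC; lra.
have f1neg y : c < y -> y <= d -> f1 y < 0.
  move=> cy yd.
  have [z] := MVT cy (fun z _ => df1 z) (wf1 c y).
  rewrite in_itv/= f1c subr0 => /andP[cz zy] ->.
  rewrite pmulr_llt0 ?subr_gt0//; apply: le_lt_trans (f2f z _) _.
    by rewrite in_itv/=; apply/andP; split; lra.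
  by rewrite pmulr_rlt0//; apply: fneg; lra.
have [z] := MVT cd (fun z _ => df z) (wf c d).
rewrite in_itv/= => /andP[cz zd] e.
have : f d < f c.
  rewrite -subr_lt0 e pmulr_llt0 ?subr_gt0//; apply: f1neg => //; exact: ltW.
by rewrite ltNge cmin// in_itv/=; apply/andP; split; lra.
Qed.

End maximum_principle.

Section resolvents.
Variable R : realType.
Implicit Types (L al be x : R).
Notation mu := (@lebesgue_measure R).

(** The solution of u'' = al u with value 1 at both ends; it equals 1 minus al times [res1]. *)
Definition cosh_ratio L al x : R :=
  cosh (Num.sqrt al * (L / 2 - x)) / cosh (Num.sqrt al * L / 2).

(* The solutions of -r'' + al r = 1, of -e'' = 1 and of g'''' - al g'' = 1 that
   satisfy the boundary conditions. *)
Definition res1 L al x : R := (1 - cosh_ratio L al x) / al.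
Definition parab L x : R := x * (L - x) / 2.
Definition beam1 L al x : R := (parab L x - res1 L al x) / al.

Lemma cosh_ratioE L al : cosh_ratio L al =
  polyhyp (Num.sqrt al) 0 0 0 (- tanh (Num.sqrt al * L / 2)) 1.
Proof.
apply/funext => x; rewrite /cosh_ratio /polyhyp /tanh.
rewrite (_ : _ * (L / 2 - x) = Num.sqrt al * L / 2 - Num.sqrt al * x); last by field.
by rewrite coshB; field; rewrite gt_eqF// cosh_gt0.
Qed.

Lemma res1E L al : 0 < al -> res1 L al =
  polyhyp (Num.sqrt al) al^-1 0 0 (tanh (Num.sqrt al * L / 2) / al) (- al^-1).
Proof.
move=> al0; apply/funext => x; rewrite /res1 cosh_ratioE /polyhyp; field.
by rewrite gt_eqF.
Qed.

Lemma parabE L al : parab L = polyhyp al 0 (L / 2) (- 2^-1) 0 0.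
Proof. by apply/funext => x; rewrite /parab /polyhyp; field. Qed.

Lemma beam1E L al : 0 < al -> beam1 L al = polyhyp (Num.sqrt al)
  (- (al * al)^-1) (L / (2 * al)) (- (2 * al)^-1)
  (- (tanh (Num.sqrt al * L / 2) / (al * al))) (al * al)^-1.
Proof.
move=> al0; apply/funext => x.
rewrite /beam1 res1E// /parab /polyhyp; field.
by rewrite gt_eqF.
Qed.

Lemma polyhyp_d2 k p q r A B : exists f1 : R -> R,
  (forall x, is_derive x 1 (polyhyp k p q r A B) (f1 x)) /\
  (forall x, is_derive x 1 f1 (2 * r + k ^+ 2 * (A * sinh (k * x) + B * cosh (k * x)))).
Proof.
exists (polyhyp k q (2 * r) 0 (B * k) (A * k)); split=> x.
  exact: is_derive_polyhyp.
apply: (is_derive_eq (is_derive_polyhyp _ _ _ _ _ _ _)).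
by rewrite /polyhyp; ring.
Qed.

Lemma cosh_ratio_d2 L al : 0 < al -> exists f1 : R -> R,
  (forall x, is_derive x 1 (cosh_ratio L al) (f1 x)) /\
  (forall x, is_derive x 1 f1 (al * cosh_ratio L al x)).
Proof.
move=> al0; rewrite cosh_ratioE.
have [f1 [d1 d2]] := polyhyp_d2 (Num.sqrt al) 0 0 0 (- tanh (Num.sqrt al * L / 2)) 1.
exists f1; split => // x; apply: (is_derive_eq (d2 x)).
by rewrite /polyhyp sqr_sqrtr ?ltW//; ring.
Qed.

Lemma res1_d2 L al : 0 < al -> exists f1 : R -> R,
  (forall x, is_derive x 1 (res1 L al) (f1 x)) /\
  (forall x, is_derive x 1 f1 (al * res1 L al x - 1)).
Proof.
move=> al0; rewrite res1E//.
have [f1 [d1 d2]] := polyhyp_d2 (Num.sqrt al) al^-1 0 0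
  (tanh (Num.sqrt al * L / 2) / al) (- al^-1).
exists f1; split => // x; apply: (is_derive_eq (d2 x)).
by rewrite /polyhyp sqr_sqrtr ?ltW//; field; rewrite gt_eqF.
Qed.

Lemma parab_d2 L : exists f1 : R -> R,
  (forall x, is_derive x 1 (parab L) (f1 x)) /\
  (forall x, is_derive x 1 f1 (- 1)).
Proof.
rewrite (parabE L 1).
have [f1 [d1 d2]] := polyhyp_d2 1 0 (L / 2) (- 2^-1) 0 0.
exists f1; split => // x; apply: (is_derive_eq (d2 x)).
by field.
Qed.

Lemma beam1_d2 L al : 0 < al -> exists f1 : R -> R,
  (forall x, is_derive x 1 (beam1 L al) (f1 x)) /\
  (forall x, is_derive x 1 f1 (- res1 L al x)).
Proof.
move=> al0; rewrite beam1E// res1E//.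
have [f1 [d1 d2]] := polyhyp_d2 (Num.sqrt al) (- (al * al)^-1) (L / (2 * al))
  (- (2 * al)^-1) (- (tanh (Num.sqrt al * L / 2) / (al * al))) (al * al)^-1.
exists f1; split => // x; apply: (is_derive_eq (d2 x)).
by rewrite /polyhyp sqr_sqrtr ?ltW//; field; rewrite gt_eqF.
Qed.

Lemma cosh_ratio_ge0 L al x : 0 <= cosh_ratio L al x.
Proof. by rewrite /cosh_ratio divr_ge0// ltW// cosh_gt0. Qed.

Lemma cosh_ratio0 L al : cosh_ratio L al 0 = 1.
Proof. by rewrite /cosh_ratio subr0 mulrA divff// gt_eqF// cosh_gt0. Qed.

Lemma cosh_ratioL L al : cosh_ratio L al L = 1.
Proof.
rewrite /cosh_ratio (_ : L / 2 - L = - (L / 2)); last by field.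
by rewrite mulrN coshN mulrA divff// gt_eqF// cosh_gt0.
Qed.

Lemma res10 L al : res1 L al 0 = 0.
Proof. by rewrite /res1 cosh_ratio0 subrr mul0r. Qed.

Lemma res1L L al : res1 L al L = 0.
Proof. by rewrite /res1 cosh_ratioL subrr mul0r. Qed.

Lemma beam10 L al : beam1 L al 0 = 0.
Proof. by rewrite /beam1 res10 /parab; ring. Qed.

Lemma beam1L L al : beam1 L al L = 0.
Proof. by rewrite /beam1 res1L /parab; ring. Qed.

Section comparison.
Variables (L : R).
Hypothesis L0 : 0 < L.

Lemma parab_ge0 x : x \in `[0, L] -> 0 <= parab L x.
Proof.
rewrite in_itv/= => /andP[x0 xL]; rewrite /parab divr_ge0// mulr_ge0//.
by rewrite subr_ge0.
Qed.

Lemma parab_le x : parab L x <= L ^+ 2 / 8.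
Proof. by rewrite /parab; have := sqr_ge0 (x - L / 2); lra. Qed.

Lemma res1_ge0 al x : 0 < al -> x \in `[0, L] -> 0 <= res1 L al x.
Proof.
move=> al0; have [f1 [d1 d2]] := res1_d2 L al0.
apply: (maximum_principle L0 al0 d1 d2).
- by move=> y _; lra.
- by rewrite res10.
- by rewrite res1L.
Qed.

(** The difference d = parab - res1 satisfies d'' = - al res1 = al d - al parab <= al d, and the
    maximum principle applies. *)
Lemma res1_le_parab al x : 0 < al -> x \in `[0, L] -> res1 L al x <= parab L x.
Proof.
move=> al0 xL; have [f1 [d1 d2]] := res1_d2 L al0.
have [e1 [de1 de2]] := parab_d2 L; rewrite -subr_ge0.
apply: (maximum_principle L0 al0 (fun y => is_derive_sub (de1 y) (d1 y))
  (fun y => is_derive_sub (de2 y) (d2 y))) xL => [y yL||].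
- by have := mulr_ge0 (ltW al0) (parab_ge0 (subset_itv_oo_cc yL)); lra.
- by rewrite res10 /parab; lra.
- by rewrite res1L /parab; lra.
Qed.

(** With d the difference of the two sides, d'' = be res1(be) - al res1(al) <= be d, because be <=
    al and res1(al) >= 0. *)
Lemma res1_le al be x : 0 < be -> be <= al -> x \in `[0, L] ->
  res1 L al x <= res1 L be x.
Proof.
move=> be0 beal xL; have al0 : 0 < al by exact: lt_le_trans beal.
have [f1 [d1 d2]] := res1_d2 L al0; have [e1 [de1 de2]] := res1_d2 L be0.
rewrite -subr_ge0.
apply: (maximum_principle L0 be0 (fun y => is_derive_sub (de1 y) (d1 y))
  (fun y => is_derive_sub (de2 y) (d2 y))) xL => [y yL||].
- have := mulr_ge0 (_ : 0 <= al - be) (res1_ge0 al0 (subset_itv_oo_cc yL)).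
  by rewrite subr_ge0 => /(_ beal); lra.
- by rewrite !res10; lra.
- by rewrite !res1L; lra.
Qed.

Lemma cosh_ratio_le al be x : 0 < be -> be <= al -> x \in `[0, L] ->
  cosh_ratio L al x <= cosh_ratio L be x.
Proof.
move=> be0 beal xL; have al0 : 0 < al by exact: lt_le_trans beal.
have [f1 [d1 d2]] := cosh_ratio_d2 L al0.
have [e1 [de1 de2]] := cosh_ratio_d2 L be0.
rewrite -subr_ge0.
apply: (maximum_principle L0 be0 (fun y => is_derive_sub (de1 y) (d1 y))
  (fun y => is_derive_sub (de2 y) (d2 y))) xL => [y yL||].
- have := mulr_ge0 (_ : 0 <= al - be) (cosh_ratio_ge0 L al y).
  by rewrite subr_ge0 => /(_ beal); lra.
- by rewrite !cosh_ratio0; lra.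
- by rewrite !cosh_ratioL; lra.
Qed.

(** The counterpart of [res1_le]: the resolvent decreases in its parameter, but its product with the
    parameter increases. Together they confine the variation of [res1] from both sides. *)
Lemma mul_res1_le al be x : 0 < be -> be <= al -> x \in `[0, L] ->
  be * res1 L be x <= al * res1 L al x.
Proof.
move=> be0 beal xL; have al0 : 0 < al by exact: lt_le_trans beal.
have mulres ga : 0 < ga -> ga * res1 L ga x = 1 - cosh_ratio L ga x.
  by move=> ga0; rewrite /res1 mulrC divfK// gt_eqF.
by rewrite !mulres//; have := cosh_ratio_le be0 beal xL; lra.
Qed.

End comparison.
End resolvents.

(** * Integrals of the resolvents and the constants M and N *)

Section beam_integrals.
Variable R : realType.
Implicit Types (L al be x : R) (f g : R -> R).
Notation mu := (@lebesgue_measure R).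

Lemma continuous_in_L1 L f : (forall x, {for x, continuous f}) -> in_L1 L f.
Proof.
move=> cf; apply: continuous_compact_integrable; first exact: segment_compact.
exact: continuous_subspaceT.
Qed.

Lemma in_L1_scale L (s : R) f : in_L1 L f -> in_L1 L (fun x => s * f x).
Proof.
by move=> fL; apply: (in_L1_mul (f := cst s)) => // x; exact: cst_continuous.
Qed.

Lemma integ_sub L f g : in_L1 L f -> in_L1 L g ->
  integ L (fun x => f x - g x) = integ L f - integ L g.
Proof. by move=> fL gL; rewrite /integ RintegralB. Qed.

Lemma integ_scale L (s : R) f : in_L1 L f ->
  integ L (fun x => s * f x) = s * integ L f.
Proof. by move=> fL; rewrite /integ RintegralZl. Qed.

Lemma eq_integ L f g : (forall x, x \in `[0, L] -> f x = g x) ->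
  integ L f = integ L g.
Proof. by move=> fg; apply: eq_Rintegral => x; rewrite inE => xL; exact: fg. Qed.

Lemma le_integ L f g : in_L1 L f -> in_L1 L g ->
  (forall x, x \in `[0, L] -> f x <= g x) -> integ L f <= integ L g.
Proof. by move=> fL gL fg; apply: le_Rintegral => // x xL; exact: fg. Qed.

Lemma normr_integ_mul_le L (f h : R -> R) (B : R) : in_L1 L h ->
  (forall x, {for x, continuous f}) -> (forall x, x \in `[0, L] -> `|f x| <= B) ->
  `|integ L (fun x => f x * h x)| <= B * norm_L1 L h.
Proof.
move=> hL cf fB; have fhL := in_L1_mul hL cf.
have nL : in_L1 L (fun x => `|h x|) by exact: integrable_norm hL.
apply: (le_trans (le_normr_Rintegral _ fhL)) => //.
rewrite /norm_L1 -integ_scale//; apply: le_integ => [||x xL].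
- exact: integrable_norm fhL.
- exact: in_L1_scale nL.
- by rewrite normrM ler_wpM2r// fB.
Qed.

Lemma integ_derive L (F f : R -> R) : 0 < L -> (forall x, is_derive x 1 F (f x)) ->
  (forall x, {for x, continuous f}) -> integ L f = F L - F 0.
Proof.
move=> L0 dF cf; have cF x : {for x, continuous F} := is_derive_continuous (dF x).
have aeF : {ae mu, forall x, x \in `]0, L[ -> is_derive x 1 F (f x)}.
  by apply: aeW => x _; exact: dF.
have acF : abs_continuous 0 L F by exact: abs_continuous_C1 dF cf.
have F0 : F x @[x --> 0^'+] --> F 0 by apply: cvg_at_right_filter; exact: cF.
have FL : F x @[x --> L^'-] --> F L by apply: cvg_at_left_filter; exact: cF.
exact: (abs_continuous_FTC L0 acF aeF (continuous_in_L1 L cf) F0 FL).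
Qed.

Lemma polyhyp_continuous k p q r A B x : {for x, continuous (@polyhyp R k p q r A B)}.
Proof. exact: is_derive_continuous (is_derive_polyhyp _ _ _ _ _ _ _). Qed.

Lemma res1_continuous L al x : 0 < al -> {for x, continuous (res1 L al)}.
Proof. by move=> al0; rewrite res1E//; exact: polyhyp_continuous. Qed.

Lemma beam1_continuous L al x : 0 < al -> {for x, continuous (beam1 L al)}.
Proof. by move=> al0; rewrite beam1E//; exact: polyhyp_continuous. Qed.

Lemma parab_continuous L x : {for x, continuous (parab L)}.
Proof. by rewrite (parabE L 0); exact: polyhyp_continuous. Qed.

Definition Kint L al : R := integ L (beam1 L al).

Section fixed_length.
Variable L : R.
Hypothesis L0 : 0 < L.

(** Lagrange's identity with test function [beam1], for which g'''' - al g'' = 1 and both boundary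
    terms vanish. *)
Lemma beam_integral al h w w1 w2 w3 : 0 < al -> beam L al h w w1 w2 w3 ->
  integ L w = integ L (fun x => beam1 L al x * h x).
Proof.
move=> al0 wP; have k2 : Num.sqrt al * Num.sqrt al = al.
  by rewrite -expr2 sqr_sqrtr// ltW.
have k0 : 0 < Num.sqrt al by rewrite sqrtr_gt0.
have gP := smooth4_polyhyp (Num.sqrt al) (- (al * al)^-1) (L / (2 * al))
  (- (2 * al)^-1) (- (tanh (Num.sqrt al * L / 2) / (al * al))) (al * al)^-1.
rewrite -beam1E// in gP.
set g1 := polyhyp _ _ _ _ _ _ in gP; set g2 := polyhyp _ _ _ _ _ _ in gP.
set g3 := polyhyp _ _ _ _ _ _ in gP; set g4 := polyhyp _ _ _ _ _ _ in gP.
have g4g2 x : g4 x - al * g2 x = 1.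
  rewrite /g4 /g2 /polyhyp; move: k2 k0; set k := Num.sqrt al => k2 k0.
  by rewrite -k2; field; rewrite gt_eqF.
have g2E x : g2 x = - res1 L al x.
  rewrite /g2 res1E// /polyhyp; move: k2 k0; set k := Num.sqrt al => k2 k0.
  by rewrite -k2; field; rewrite gt_eqF.
have g20 : g2 0 = 0 by rewrite g2E res10 oppr0.
have g2L : g2 L = 0 by rewrite g2E res1L oppr0.
have := lagrange_identity wP gP g4g2 (lexx 0) L0 (lexx L)
  (lagrange_cvg_at0 L0 wP gP g4g2 (beam10 _ _) g20)
  (lagrange_cvg_atL L0 wP gP g4g2 (beam1L _ _) g2L).
have ghL : in_L1 L (fun x => beam1 L al x * h x).
  by apply: in_L1_mul (beam_L1 wP) _ => x; exact: beam1_continuous.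
have wL : in_L1 L (fun x => 1 * w x).
  exact: in_L1_scale (beam_in_L1 wP).
rewrite -/(integ L _) integ_sub// integ_scale ?mul1r; last exact: beam_in_L1 wP.
by move/eqP; rewrite subrr subr_eq0 => /eqP.
Qed.

(** Write 1 = - r'' + be r with r = [res1 L be] under the integral of [beam1 L al], and integrate by
    parts twice, using - beam1'' = res1. *)
Lemma Kint_res al be : 0 < al -> 0 < be -> Kint L al =
  integ L (fun x => res1 L be x * res1 L al x) +
  be * integ L (fun x => res1 L be x * beam1 L al x).
Proof.
move=> al0 be0.
have [g1 [dg1 dg2]] := beam1_d2 L al0; have [r1 [dr1 dr2]] := res1_d2 L be0.
have cr x : {for x, continuous (res1 L be)} by exact: res1_continuous.
have cs x : {for x, continuous (res1 L al)} by exact: res1_continuous.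
have cg x : {for x, continuous (beam1 L al)} by exact: beam1_continuous.
have crg x : {for x, continuous (fun y => res1 L be y * beam1 L al y)}.
  by apply: cvgM; [exact: cr|exact: cg].
have crs x : {for x, continuous (fun y => res1 L be y * res1 L al y)}.
  by apply: cvgM; [exact: cr|exact: cs].
have cb x : {for x, continuous (fun y => (- be) * (res1 L be y * beam1 L al y))}.
  by apply: cvgMr; exact: crg.
pose f x := beam1 L al x - res1 L be x * res1 L al x
  - be * (res1 L be x * beam1 L al x).
have cf x : {for x, continuous f}.
  apply: cvgB; first by apply: cvgB; [exact: cg|exact: crs].
  by apply: cvgMr; exact: crg.
have dF x : is_derive x 1 (fun y => res1 L be y * g1 y - r1 y * beam1 L al y) (f x).
  apply: (is_derive_eq (is_derive_sub (is_derive_mul (dr1 x) (dg2 x))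
    (is_derive_mul (dr2 x) (dg1 x)))).
  by rewrite /f; ring.
have := integ_derive L0 dF cf.
rewrite !res10 !res1L !beam10 !beam1L /f.
have i1 := continuous_in_L1 L cg; have i2 := continuous_in_L1 L crs.
have i3 := continuous_in_L1 L crg.
rewrite integ_sub; [|exact: in_L1_sub|]; last first.
  exact: in_L1_scale i3.
rewrite integ_sub// integ_scale// /Kint; lra.
Qed.

Lemma Kint_parab al : 0 < al -> Kint L al = integ L (fun x => res1 L al x * parab L x).
Proof.
move=> al0; rewrite (Kint_res al0 al0).
have cr x : {for x, continuous (res1 L al)} by exact: res1_continuous.
have cg x : {for x, continuous (beam1 L al)} by exact: beam1_continuous.
have i1 : in_L1 L (fun x => res1 L al x * res1 L al x).
  by apply: in_L1_mul => //; exact: continuous_in_L1.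
have i2 : in_L1 L (fun x => res1 L al x * beam1 L al x).
  by apply: in_L1_mul => //; exact: continuous_in_L1.
rewrite -[al * _]opprK -mulNr -integ_scale// -integ_sub//; last first.
  exact: in_L1_scale i2.
by apply: eq_integ => x _; rewrite /beam1; field; rewrite gt_eqF.
Qed.

(** With X the integral of res1(be) res1(al) and Y that of res1(be) beam1(al), one has K(al) = X +
    be Y by [Kint_res], and K(be) = X + al Y by [Kint_parab] and parab = res1(al) + al beam1(al).
    The products al be Y cancel in the combination. *)
Lemma Kint_increment a al be : 0 < al -> 0 < be ->
  (al - a) * Kint L al - (be - a) * Kint L be =
  (al - be) * integ L (fun x => res1 L be x * (res1 L al x + a * beam1 L al x)).
Proof.
move=> al0 be0.
have cr x : {for x, continuous (res1 L be)} by exact: res1_continuous.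
have cs x : {for x, continuous (res1 L al)} by exact: res1_continuous.
have cg x : {for x, continuous (beam1 L al)} by exact: beam1_continuous.
have i1 : in_L1 L (fun x => res1 L be x * res1 L al x).
  by apply: in_L1_mul => //; exact: continuous_in_L1.
have i2 : in_L1 L (fun x => res1 L be x * beam1 L al x).
  by apply: in_L1_mul => //; exact: continuous_in_L1.
have lin s : integ L (fun x => res1 L be x * (res1 L al x + s * beam1 L al x)) =
    integ L (fun x => res1 L be x * res1 L al x) +
    s * integ L (fun x => res1 L be x * beam1 L al x).
  rewrite -[s * integ _ _]opprK -mulNr -integ_scale// -integ_sub//; last first.
    exact: in_L1_scale i2.
  by apply: eq_integ => x _; ring.
have Kbe : Kint L be = integ L (fun x => res1 L be x * res1 L al x) +
    al * integ L (fun x => res1 L be x * beam1 L al x).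
  rewrite -lin (Kint_parab be0); apply: eq_integ => x _.
  by rewrite /beam1; field; rewrite gt_eqF.
by rewrite lin Kbe (Kint_res al0 be0); ring.
Qed.

(** K(a) is the integral of res1(a) parab, so the integrand of [Kint_increment] is compared factor
    by factor. Each comparison loses a factor 2, whence the denominator 4 al be. *)
Lemma Kint_increment_ge a al be : 0 < a -> a / 2 <= be -> be < al ->
  (al - be) * (a ^+ 2 / (4 * (al * be)) * Kint L a) <=
  (al - a) * Kint L al - (be - a) * Kint L be.
Proof.
move=> a0 abe beal; have be0 : 0 < be by lra.
have al0 : 0 < al by lra.
rewrite Kint_increment// ler_wpM2l//; first lra.
have cr x : {for x, continuous (res1 L be)} by exact: res1_continuous.
have cs x : {for x, continuous (res1 L al)} by exact: res1_continuous.
have ca x : {for x, continuous (res1 L a)} by exact: res1_continuous.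
have cg x : {for x, continuous (beam1 L al)} by exact: beam1_continuous.
have cp x : {for x, continuous (parab L)} by exact: parab_continuous.
have i0 : in_L1 L (fun x => res1 L a x * parab L x).
  by apply: in_L1_mul => //; exact: continuous_in_L1.
rewrite (Kint_parab a0) -integ_scale//; apply: le_integ.
- exact: in_L1_scale i0.
- apply: in_L1_mul => //; apply: continuous_in_L1 => x.
  by apply: cvgD; [exact: cs|apply: cvgMr; exact: cg].
move=> x xL.
have ra0 := res1_ge0 L0 a0 xL; have e0 := parab_ge0 xL.
have rs0 := res1_ge0 L0 al0 xL; have rse := res1_le_parab L0 al0 xL.
(* For a <= be the product of parameter and resolvent increases, with a factor 2 to spare; for be <
   a the resolvent itself decreases and a <= 2 be. *)
have h1 : a * res1 L a x <= 2 * be * res1 L be x.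
  have [abe'|bea] := leP a be.
    have := mul_res1_le L0 a0 abe' xL; have := mulr_ge0 (ltW a0) ra0; lra.
  have h := res1_le L0 be0 (ltW bea) xL.
  have : (2 * be) * res1 L a x <= 2 * be * res1 L be x by rewrite ler_wpM2l//; lra.
  have := mulr_ge0 (_ : 0 <= 2 * be - a) ra0; lra.
have h2 : a * parab L x <= 2 * al * (res1 L al x + a * beam1 L al x).
  have -> : 2 * al * (res1 L al x + a * beam1 L al x) =
     a * parab L x + ((2 * al - a) * res1 L al x + a * (parab L x - res1 L al x)).
    by rewrite /beam1; field; rewrite gt_eqF.
  by rewrite lerDl addr_ge0// mulr_ge0//; lra.
have h3 := ler_pM (mulr_ge0 (ltW a0) ra0) (mulr_ge0 (ltW a0) e0) h1 h2.
by rewrite mulrAC ler_pdivrMr ?mulr_gt0//; lra.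
Qed.

(** The difference splits into two terms of opposite signs, each of size at most the right-hand
    side, so their sum obeys the same bound without doubling. The second is handled by be (res1(be)
    - res1(al)) <= (al - be) res1(al), a form of [mul_res1_le]. *)
Lemma beam1_sub_le al be x : 0 < be -> be < al -> x \in `[0, L] ->
  `|beam1 L al x - beam1 L be x| <= (al - be) / (al * be) * (L ^+ 2 / 8).
Proof.
move=> be0 beal xL; have al0 : 0 < al by lra.
have e0 := parab_ge0 xL; have eL := parab_le L x.
have ra0 := res1_ge0 L0 al0 xL; have rb0 := res1_ge0 L0 be0 xL.
have rae := res1_le_parab L0 al0 xL; have rbe := res1_le_parab L0 be0 xL.
have rba := res1_le L0 be0 (ltW beal) xL.
have mba := mul_res1_le L0 be0 (ltW beal) xL.
have -> : beam1 L al x - beam1 L be x =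
    (al * be)^-1 * ((al - be) * (res1 L be x - parab L x)
      + be * (res1 L be x - res1 L al x)).
  by rewrite /beam1; field; rewrite !gt_eqF.
have -> : (al - be) / (al * be) * (L ^+ 2 / 8) =
    (al * be)^-1 * ((al - be) * (L ^+ 2 / 8)) by field; rewrite !gt_eqF.
rewrite normrM gtr0_norm ?invr_gt0 ?mulr_gt0//; apply: ler_wpM2l.
  by rewrite invr_ge0 mulr_ge0// ltW.
have m1 : 0 <= (al - be) * (parab L x - res1 L be x) by rewrite mulr_ge0//; lra.
have m2 : 0 <= be * (res1 L be x - res1 L al x) by rewrite mulr_ge0//; lra.
have m3 : 0 <= (al - be) * (parab L x - res1 L al x) by rewrite mulr_ge0//; lra.
have m4 : 0 <= (al - be) * (L ^+ 2 / 8 - parab L x) by rewrite mulr_ge0//; lra.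
have m5 : 0 <= (al - be) * res1 L be x by rewrite mulr_ge0//; lra.
have m6 : 0 <= (al - be) * res1 L al x by rewrite mulr_ge0//; lra.
by rewrite ler_norml; apply/andP; split; lra.
Qed.

Lemma beam1_ge0 al x : 0 < al -> x \in `[0, L] -> 0 <= beam1 L al x.
Proof.
move=> al0 xL; apply: divr_ge0 (ltW al0).
by rewrite subr_ge0; exact: res1_le_parab.
Qed.

Lemma beam1_le al x : 0 < al -> x \in `[0, L] -> beam1 L al x <= L ^+ 2 / (8 * al).
Proof.
move=> al0 xL; have := res1_ge0 L0 al0 xL; have := parab_le L x => h1 h2.
rewrite /beam1 ler_pdivrMr//.
have -> : L ^+ 2 / (8 * al) * al = L ^+ 2 / 8 by field; rewrite gt_eqF.
lra.
Qed.

Lemma Kint_ge0 al : 0 < al -> 0 <= Kint L al.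
Proof.
by move=> al0; apply: Rintegral_ge0 => x xL; exact: beam1_ge0.
Qed.

Lemma Kint_explicit al : 0 < al -> Kint L al = L ^+ 3 / (12 * al) - L / al ^+ 2
  + 2 / (al ^+ 2 * Num.sqrt al) * tanh (Num.sqrt al * L / 2).
Proof.
move=> al0; set k := Num.sqrt al; set T := tanh (k * L / 2).
have k0 : 0 < k by rewrite sqrtr_gt0.
have kk : k * k = al by rewrite -expr2 sqr_sqrtr// ltW.
(* An explicit antiderivative of [beam1]; its cubic term lies outside the family [polyhyp]. *)
pose F x := polyhyp k 0 (- (al * al)^-1) (L / (4 * al)) ((al * al)^-1 / k)
  (- (T / (al * al)) / k) x + (- (6 * al)^-1) * (x * (x * x)).
have dF x : is_derive x 1 F (beam1 L al x).
  have did : is_derive x (1 : R) (fun y : R => y) 1 by exact: is_derive_id.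
  apply: (is_derive_eq (is_derive_add (is_derive_polyhyp _ _ _ _ _ _ x)
    (is_derive_scale (- (6 * al)^-1) (is_derive_mul did (is_derive_mul did did))))).
  by rewrite beam1E// -/k -/T /polyhyp; field; rewrite !gt_eqF.
have cg x : {for x, continuous (beam1 L al)} by exact: beam1_continuous.
rewrite /Kint (integ_derive L0 dF cg) /F /polyhyp !mulr0 sinh0 cosh0.
have -> : k * L = k * L / 2 + k * L / 2 by field.
rewrite sinhD coshD /T /tanh.
have c0 := cosh_gt0 (k * L / 2); have cs := cosh2_sinh2 (k * L / 2).
move: c0 cs; set C := cosh _; set S := sinh _ => c0 cs.
(* After the half-angle formulas the evaluated side carries the factor 1 + C^2 - S^2, so the 2 of
   the closed form is written in that shape to leave an identity of rational functions. *)
have -> : 2 / (al ^+ 2 * k) * (S / C) =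
    (al ^+ 2 * k)^-1 * (S / C) * (1 + (C ^+ 2 - S ^+ 2)) by rewrite cs; ring.
by field; rewrite !gt_eqF.
Qed.

End fixed_length.

Lemma powR_5half (a : R) : 0 < a -> a `^ (5 / 2) = a ^+ 2 * Num.sqrt a.
Proof.
move=> a0; rewrite (_ : 5 / 2 = 2 + 2^-1 :> R); last by field.
by rewrite powRD ?gt_eqF ?implybT// powR_mulrn ?ltW// powR12_sqrt// ltW.
Qed.

Lemma constM_Kint L a c : 0 < L -> 0 < a -> constM L a c = 1 + c * Kint L a.
Proof. by move=> L0 a0; rewrite /constM powR_5half// Kint_explicit. Qed.

(** The function z cosh z - sinh z vanishes at 0 and has derivative z sinh z. *)
Lemma tanh_le (y : R) : 0 < y -> tanh y <= y.
Proof.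
move=> y0; rewrite /tanh ler_pdivrMr ?cosh_gt0// -subr_ge0.
have did x : is_derive x (1 : R) (fun z : R => z) 1 by exact: is_derive_id.
have dc x : is_derive x (1 : R) (fun z : R => cosh z) (sinh x).
  have -> : (fun z : R => cosh z) = (fun z => cosh (1 * z)).
    by apply/funext => z; rewrite mul1r.
  by apply: (is_derive_eq (is_derive_coshM x 1)); rewrite !mul1r.
have ds x : is_derive x (1 : R) (fun z : R => sinh z) (cosh x).
  have -> : (fun z : R => sinh z) = (fun z => sinh (1 * z)).
    by apply/funext => z; rewrite mul1r.
  by apply: (is_derive_eq (is_derive_sinhM x 1)); rewrite !mul1r.
pose f (z : R) := z * cosh z - sinh z.
have df x : is_derive x 1 f (x * sinh x).
  apply: (is_derive_eq (is_derive_sub (is_derive_mul (did x) (dc x)) (ds x))).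
  ring.
have cf : {within `[0, y], continuous f}.
  by apply: continuous_subspaceT => x; exact: is_derive_continuous (df x).
have [z] := MVT y0 (fun z _ => df z) cf.
rewrite in_itv/= /f mul0r sinh0 !subr0 => /andP[z0 _] ->.
exact: mulr_ge0 (mulr_ge0 (ltW z0) (ltW (sinh_gt0 z0))) (ltW y0).
Qed.

(** With k the square root of a, N - M = c L^2 / (4 a k) (k L / 2 - tanh (k L / 2)), which is
    nonnegative by [tanh_le]. *)
Lemma constM_le_constN L a c : 0 < L -> 0 < a -> 0 < c ->
  constM L a c <= constN L a c.
Proof.
move=> L0 a0 c0; rewrite /constM /constN powR_5half// lerD2l.
apply: (ler_wpM2l (ltW c0)).
have k0 : 0 < Num.sqrt a by rewrite sqrtr_gt0.
have kk : Num.sqrt a * Num.sqrt a = a by rewrite -expr2 sqr_sqrtr// ltW.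
have y0 : 0 < Num.sqrt a * L / 2 by rewrite divr_gt0// mulr_gt0.
have Ty := tanh_le y0; move: Ty.
set T := tanh _; set k := Num.sqrt a in kk k0 * => Ty.
rewrite -subr_ge0 (_ : _ - _ = L ^+ 2 / (4 * a * k) * (k * L / 2 - T)); last first.
  by field; rewrite !gt_eqF.
by rewrite mulr_ge0 ?subr_ge0// divr_ge0 ?sqr_ge0// ltW// !mulr_gt0.
Qed.

End beam_integrals.

(** * Uniqueness *)

Section uniqueness.
Variables (R : realType) (L a b c : R) (p : R -> R).
Hypotheses (hL : 0 < L) (ha : 0 < a) (hb : 0 < b) (hc : 0 < c).
Hypothesis hp : in_L1 L p.
Hypothesis hcond : 2 * a ^+ 2 * constM L a c ^+ 2 / (b * L ^+ 2 * constN L a c)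
  > norm_L1 L p.
Notation mu := (@lebesgue_measure R).

Lemma constM_ge1 : 1 <= constM L a c.
Proof.
rewrite constM_Kint// lerDl; apply: mulr_ge0 (ltW hc) _.
exact: Kint_ge0.
Qed.

(** From M <= N follows M^2 / N <= M; the smallness of [p] is used below in this form. *)
Lemma norm_p_lt : b * L ^+ 2 * norm_L1 L p < 2 * a ^+ 2 * constM L a c.
Proof.
have M1 := constM_ge1; have MN := constM_le_constN hL ha hc.
have M0 : 0 < constM L a c by exact: lt_le_trans M1.
have N0 : 0 < constN L a c by exact: lt_le_trans MN.
have D0 : 0 < b * L ^+ 2 by rewrite mulr_gt0// exprn_gt0.
move: hcond; rewrite ltr_pdivlMr; last exact: mulr_gt0.
move=> h; rewrite -(ltr_pM2r N0) mulrAC.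
have -> : b * L ^+ 2 * constN L a c * norm_L1 L p =
  norm_L1 L p * (b * L ^+ 2 * constN L a c) by ring.
apply: lt_le_trans h _.
rewrite [constM L a c ^+ 2]expr2 mulrA; apply: ler_wpM2l => //.
by apply: mulr_ge0 (ltW M0); apply: mulr_ge0 => //; exact: sqr_ge0.
Qed.

Lemma scalar_equation q w w1 w2 w3 : 0 < a + b * q -> integ L w = q ->
  beam L (a + b * q) (fun x => p x - c * q) w w1 w2 w3 ->
  q * (1 + c * Kint L (a + b * q)) = integ L (fun x => beam1 L (a + b * q) x * p x).
Proof.
move=> al0 wq wP; have := beam_integral hL al0 wP; rewrite wq.
have cg x : {for x, continuous (beam1 L (a + b * q))} by exact: beam1_continuous.
rewrite (@eq_integ _ L (fun x => beam1 L (a + b * q) x * (p x - c * q))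
  (fun x => beam1 L (a + b * q) x * p x - (c * q) * beam1 L (a + b * q) x)).
  rewrite integ_sub; [|exact: in_L1_mul|exact/in_L1_scale/continuous_in_L1].
  rewrite integ_scale; last exact: continuous_in_L1.
  rewrite -/(Kint _ _); lra.
by move=> x _; ring.
Qed.

Lemma scalar_equation_inj q1 q2 :
  a / 2 <= a + b * q1 -> a / 2 <= a + b * q2 ->
  q1 * (1 + c * Kint L (a + b * q1)) = integ L (fun x => beam1 L (a + b * q1) x * p x) ->
  q2 * (1 + c * Kint L (a + b * q2)) = integ L (fun x => beam1 L (a + b * q2) x * p x) ->
  q1 = q2.
Proof.
wlog q21 : q1 q2 / q2 < q1.
  move=> H h1 h2 e1 e2; have [lt|lt|//] := ltgtP q1 q2.
    by apply/esym; exact: H.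
  exact: H.
move=> h1 h2; have a0 := ha.
have beal : a + b * q2 < a + b * q1 by rewrite ltrD2l ltr_pM2l.
have := Kint_increment_ge hL ha h2 beal.
have al0 : 0 < a + b * q1 by lra.
have be0 : 0 < a + b * q2 by lra.
set K1 := Kint L (a + b * q1); set K2 := Kint L (a + b * q2) => hK e1 e2.
have cg q x : 0 < a + b * q -> {for x, continuous (beam1 L (a + b * q))}.
  by move=> ?; exact: beam1_continuous.
set al := a + b * q1 in h1 beal al0 e1 hK cg *.
set be := a + b * q2 in h2 beal be0 e2 hK cg *.
have diff : q1 * (1 + c * K1) - q2 * (1 + c * K2) <=
    (al - be) / (al * be) * (L ^+ 2 / 8) * norm_L1 L p.
  rewrite e1 e2 -integ_sub; last 2 first.
  - by apply: in_L1_mul => // x; exact: beam1_continuous.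
  - by apply: in_L1_mul => // x; exact: beam1_continuous.
  have := @normr_integ_mul_le _ L (fun x => beam1 L al x - beam1 L be x) p
    ((al - be) / (al * be) * (L ^+ 2 / 8)) hp.
  rewrite (@eq_integ _ L (fun x => (beam1 L al x - beam1 L be x) * p x)
    (fun x => beam1 L al x * p x - beam1 L be x * p x)); last first.
    by move=> x _; ring.
  move=> H; apply: le_trans (ler_norm _) _; apply: H => x.
    by apply: cvgB; exact: beam1_continuous.
  exact: beam1_sub_le.
have np := norm_p_lt; rewrite constM_Kint// in np.
have D0 : 0 < al - be by lra.
have ab0 : 0 < al * be by exact: mulr_gt0.
have ab4 : a ^+ 2 <= 4 * (al * be).
  have : (a / 2) * (a / 2) <= al * be by apply: ler_pM => //; lra.
  lra.
have KA := Kint_ge0 hL ha.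
(* Since b q = al - a, multiplication by [b] turns the left sides of the scalar equations into the
   increment bounded by [Kint_increment_ge]. *)
have s1 : b * (q1 * (1 + c * K1) - q2 * (1 + c * K2)) =
    (al - be) + c * ((al - a) * K1 - (be - a) * K2) by rewrite /al /be; ring.
have s2 : (al - be) + c * ((al - be) * (a ^+ 2 / (4 * (al * be)) * Kint L a)) <=
    b * ((al - be) / (al * be) * (L ^+ 2 / 8) * norm_L1 L p).
  apply: (@le_trans _ _ (b * (q1 * (1 + c * K1) - q2 * (1 + c * K2)))).
    by rewrite s1 lerD2l; apply: (ler_wpM2l (ltW hc)).
  exact: (ler_wpM2l (ltW hb)).
have s3 : (4 * (al * be) + c * a ^+ 2 * Kint L a) * (al - be) <=
    b * L ^+ 2 * norm_L1 L p / 2 * (al - be).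
  have -> : (4 * (al * be) + c * a ^+ 2 * Kint L a) * (al - be) =
    4 * (al * be) *
    ((al - be) + c * ((al - be) * (a ^+ 2 / (4 * (al * be)) * Kint L a))).
    by field; rewrite !gt_eqF.
  have -> : b * L ^+ 2 * norm_L1 L p / 2 * (al - be) =
    4 * (al * be) * (b * ((al - be) / (al * be) * (L ^+ 2 / 8) * norm_L1 L p)).
    by field; rewrite !gt_eqF.
  by apply: ler_wpM2l s2; lra.
(* By [ab4] the left factor is at least a^2 (1 + c K(a)), whereas [np] puts the right factor
   strictly below that value. *)
move: s3; rewrite ler_pM2r// => s3; exfalso.
have : b * L ^+ 2 * norm_L1 L p / 2 < a ^+ 2 * (1 + c * Kint L a) by lra.
have -> : a ^+ 2 * (1 + c * Kint L a) = a ^+ 2 + c * a ^+ 2 * Kint L a by ring.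
lra.
Qed.

Lemma beam_unique u v u1 u2 u3 v1 v2 v3 :
  a / 2 <= a + b * integ L u -> a / 2 <= a + b * integ L v ->
  beam L (a + b * integ L u) (fun x => p x - c * integ L u) u u1 u2 u3 ->
  beam L (a + b * integ L v) (fun x => p x - c * integ L v) v v1 v2 v3 ->
  forall x, x \in `[0, L] -> u x = v x.
Proof.
move=> hu hv uP vP x xL; have a0 := ha.
have al0 : 0 < a + b * integ L u by lra.
have be0 : 0 < a + b * integ L v by lra.
have e := scalar_equation_inj hu hv (scalar_equation al0 erefl uP)
  (scalar_equation be0 erefl vP).
rewrite (green_representation hL al0 uP xL) (green_representation hL be0 vP xL).
by rewrite e.
Qed.

(** [solS] is an integral formula without known derivatives. [W] is built from the solutions for the
    loads phi and 1, agrees with it on [0, L], and brings the derivatives along. *)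
Lemma fixed_point_beam phi : fixed_point_in_ball L a b c p phi ->
  exists W w1 w2 w3, [/\ forall x, x \in `[0, L] -> W x = solS L a c phi x,
    a / 2 <= a + b * integ L W &
    beam L (a + b * integ L W) (fun x => p x - c * integ L W) W w1 w2 w3].
Proof.
case=> phiL phi2p phifix; have a0 := ha; have M1 := constM_ge1.
have [f [f1 [f2 [f3 fP]]]] := beam_exists hL ha phiL.
have [g [g1 [g2 [g3 gP]]]] := beam_exists hL ha (in_L1_cst L (1 : R)).
have fE x : x \in `[0, L] -> integ L (fun s => green L a x s * phi s) = f x.
  by move=> xL; rewrite -(green_representation hL ha fP xL).
have gE x : x \in `[0, L] -> integ L (fun s => green L a x s) = g x.
  move=> xL; rewrite (green_representation hL ha gP xL).
  by apply: eq_integ => s _; rewrite mulr1.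
have ig : integ L g = Kint L a.
  by rewrite (beam_integral hL ha gP); apply: eq_integ => x _; rewrite mulr1.
have M0 : 0 < 1 + c * Kint L a.
  by move: M1; rewrite constM_Kint//; lra.
(* Chosen so that [s] equals c times the integral of [W]: the multiple of [g] then accounts for the
   nonlocal term, and the Green function formula for S phi results. *)
pose s := c * integ L f / (1 + c * Kint L a).
have WE x : x \in `[0, L] -> f x - s * g x = solS L a c phi x.
  move=> xL; rewrite /solS fE// gE//.
  rewrite (@eq_integ _ L _ g gE) (@eq_integ _ L _ f fE) ig /s.
  by field; rewrite gt_eqF.
have WP := beam_sub s fP gP.
pose W x := f x - s * g x; rewrite -/W in WP.
have fL1 := beam_in_L1 fP; have gL1 := beam_in_L1 gP.
have iW : integ L W = integ L f / (1 + c * Kint L a).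
  rewrite /W integ_sub ?integ_scale//; last exact: in_L1_scale.
  by rewrite ig /s; field; rewrite gt_eqF.
have sE : s = c * integ L W by rewrite iW /s; ring.
have iS : integ L (solS L a c phi) = integ L W.
  by apply: eq_integ => x xL; rewrite -WE.
(* Here [beam1] is at most L^2 / (8 a) and |phi|_1 <= 2 |p|_1, so the left side is at most b L^2
   |p|_1 / (4 a M), which [norm_p_lt] bounds by a / 2. *)
have qbound : b * `|integ L W| <= a / 2.
  rewrite iW normrM normfV (gtr0_norm M0) mulrA ler_pdivrMr//.
  have fphi : `|integ L f| <= L ^+ 2 / (8 * a) * (2 * norm_L1 L p).
    rewrite (beam_integral hL ha fP).
    apply: (@le_trans _ _ (L ^+ 2 / (8 * a) * norm_L1 L phi)).
      apply: normr_integ_mul_le => // [x|x xL]; first exact: beam1_continuous.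
      by rewrite ger0_norm; [exact: beam1_le|exact: beam1_ge0].
    apply: ler_wpM2l phi2p; apply: divr_ge0; first exact: sqr_ge0.
    by apply: mulr_ge0 (ltW ha).
  apply: (le_trans (ler_wpM2l (ltW hb) fphi)).
  have np := norm_p_lt; rewrite constM_Kint// in np.
  rewrite (_ : b * _ = b * L ^+ 2 * norm_L1 L p / (4 * a)); last first.
    by field; rewrite gt_eqF.
  rewrite ler_pdivrMr; last by lra.
  apply: (le_trans (ltW np)).
  by rewrite le_eqVlt; apply/orP; left; apply/eqP; field.
exists W, (fun x => f1 x - s * g1 x), (fun x => f2 x - s * g2 x),
  (fun x => f3 x - s * g3 x); split => //.
  have := ler_norm (- (b * integ L W)); rewrite normrN normrM (gtr0_norm hb); lra.
(* [opA] differentiates [solS] itself; agreement with [W] on an open interval transfers the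
   derivatives, one order at a time. *)
have S2 x : x \in `]0, L[ -> (solS L a c phi)^`(2)%classic x = f2 x - s * g2 x.
  move=> xL.
  have SW : {in `]0, L[, solS L a c phi =1 W}.
    by move=> y yL; rewrite -WE//; exact: subset_itv_oo_cc yL.
  have S1 : {in `]0, L[, (solS L a c phi)^`()%classic =1 (fun y => f1 y - s * g1 y)}.
    move=> y yL; have := eq_in_is_derive SW yL (beam_d1 WP yL).
    by case=> _; rewrite derive1E.
  have := eq_in_is_derive S1 xL (beam_d2 WP xL).
  by case=> _; rewrite derive1nS derive1E.
split.
- exact: beam_d1 WP.
- exact: beam_d2 WP.
- exact: beam_d3 WP.
- exact: beam_ac WP.
(* The fixed-point equation replaces phi by p plus b times the integral of [W] times W'', and the
   last term raises the coefficient from a to a + b q. *)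
- apply: lebesgue_aeS2 phifix (beam_ae WP) => x /= phix w3x xL.
  apply: (is_derive_eq (w3x xL)).
  rewrite -phix ?(subset_itv_oo_cc xL)// /opA S2// iS sE; ring.
- exact: in_L1_sub hp (in_L1_cst _ _).
- exact: beam_0 WP.
- exact: beam_L WP.
- exact: beam_cvg0 WP.
- exact: beam_cvgL WP.
- exact: beam_cvg20 WP.
- exact: beam_cvg2L WP.
Qed.

End uniqueness.

Theorem theorem3p2 (R : realType) (L a b c : R) (p : R -> R)
  (hL : 0 < L) (ha : 0 < a) (hb : 0 < b) (hc : 0 < c)
  (hp : in_L1 L p)
  (hcond : 2 * a ^+ 2 * constM L a c ^+ 2 / (b * L ^+ 2 * constN L a c)
             > norm_L1 L p) :
  (forall phi : R -> R, fixed_point_in_ball L a b c p phi ->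
     forall w : R -> R, W41 L w -> bvp_solution L a b c p w ->
       0 <= integ L w ->
       forall x, x \in `[0, L] -> w x = solS L a c phi x)
  /\
  (forall u v : R -> R,
     Xplus L u -> bvp_solution L a b c p u ->
     Xplus L v -> bvp_solution L a b c p v ->
     forall x, x \in `[0, L] -> u x = v x).
Proof.
have half q : 0 <= q -> a / 2 <= a + b * q.
  by move=> q0; have := mulr_ge0 (ltW hb) q0; lra.
split=> [phi phiP w w41 wP w0 x xL|u v [u41 u0] uP [v41 v0] vP x xL].
  have [w1 [w2 [w3 wB]]] := bvp_beam hp w41 wP.
  have [W [W1 [W2 [W3 [WS Wa WB]]]]] := fixed_point_beam hL ha hb hc hp hcond phiP.
  rewrite -WS//; exact: (beam_unique hL ha hb hc hp hcond (half _ w0) Wa wB WB xL).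
have [u1 [u2 [u3 uB]]] := bvp_beam hp u41 uP.
have [v1 [v2 [v3 vB]]] := bvp_beam hp v41 vP.
exact: (beam_unique hL ha hb hc hp hcond (half _ u0) (half _ v0) uB vB xL).
Qed.
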